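(* Let $K$ be a normal subgroup of a finite group $H$, $G=H/K$, let $A_1$ be a unitary $K$-interior $H$-algebra over $\mathcal{O}$, and let $A=\bigoplus_{\sigma\in G}A_\sigma$ be the associated strongly $G$-graded $H$-interior algebra. Let $b$ be a primitive idempotent of $A_1^K$ lying in $Z(A_1)$, let $P\le K$ be a defect group of $b$, and let $\bar b=\operatorname{Br}_P(b)\in A_1(P)$. With the groups $G_b$, $G[b]$, $G[\bar b]$, $\overline{N_H(P)}[\bar b]$, $\overline{C_H(P)}[\bar b]$ and the group extensions $$(1)\quad 1\to \bar{C}_1^{*}\to \operatorname{hU}(\bar{C})\to G[b]\to 1,$$ $$(2)\quad 1\to \bar{D}_1^{*}\to \operatorname{hU}(\bar{D})\to \overline{C_H(P)}[\bar{b}]\to 1,$$ $$(3)\quad 1\to \bar{E}_1^{*}\to \operatorname{hU}(\bar{E})\to G[\bar{b}]\to 1$$ defined in the context, the following statements hold. (1) $G_b$ equals $N_H(P)_bK/K=N_H(P)_{\bar b}K/K$. (2) The groups $G[b]$ and $G[\bar b]$ are equal and they both coincide with $\overline{N_H(P)}[\bar b]$. (3) The extensions (1) and (3) are isomorphic. (4) The isomorphism between the extensions (1) and (3) is compatible with the identity isomorphism $G[b]\to\overline{N_H(P)}[\bar b]$, and preserves the action of $G_b\simeq N_H(P)_{\bar b}/N_K(P)$ on the two extensions. (5) There is a monomorphism from extension (2) into extension (3), which is also compatible with the natural monomorphism $\overline{C_H(P)}[\bar b]\to G[b]$, and preserves the action of $G_b$ on these extensions.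
   Context: Base ring. $p$ is a prime; $\mathcal{O}$ is a discrete valuation ring with residue field $k$ of characteristic $p$ (the case $\mathcal{O}=k$ is also allowed); no assumption is made on the size of $\mathcal{O}$ and $k$. $J(\cdot)$ is the Jacobson radical, $Z(\cdot)$ the center. $K$-interior $H$-algebra. This is an $\mathcal{O}$-algebra $A_1$ with an action $a\mapsto a^h$ of $H$ by $\mathcal{O}$-algebra automorphisms (right exponential notation) and a group homomorphism $K\to A_1^*$, $y\mapsto y\cdot 1$, such that $(y\cdot 1)^h=(h^{-1}yh)\cdot 1$ for $y\in K,h\in H$, and $a^y=(y\cdot1)^{-1}a(y\cdot1)$ for $y\in K$, $a\in A_1$. The algebra $A$. $A=A_1\otimes_{\mathcal{O}K}\mathcal{O}H$ with multiplication $(a\otimes x)(a'\otimes y)=a\,(a')^{x^{-1}}\otimes xy$ for $a,a'\in A_1$, $x,y\in H$. It is strongly $G$-graded with $A_\sigma=A_1\otimes x$ for any $x\in\sigma$, $A_1$ is identified with $A_1\otimes 1$, and $h\mapsto 1\otimes h$ makes $A$ an $H$-interior algebra; $H$ acts on $A$ by conjugation, $a^h=h^{-1}\cdot a\cdot h$, so $(a\otimes x)^h=a^h\otimes h^{-1}xh$. Fixed points and Brauer construction. For an algebra (or module) $B$ with an action of a group $X$, $B^X$ denotes the fixed elements. For subgroups $Q\le X$, $\operatorname{Tr}_Q^X:B^Q\to B^X$ is the relative trace, and $B_Q^X=\operatorname{Tr}_Q^X(B^Q)$. For a $p$-subgroup $P$, the Brauer quotient is $B(P)=k\otimes_{\mathcal{O}}\bigl(B^P/\sum_{Q<P}B_Q^P\bigr)$,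 with canonical map $\operatorname{Br}_P:B^P\to B(P)$. If $P\le K$, then $A(P)=\bigoplus_{\sigma\in G}A(P)_\sigma$ is a $G$-graded $N_H(P)$-algebra with $A(P)_\sigma=k\otimes_{\mathcal{O}}\bigl(A_\sigma^P/\sum_{Q<P}(A_\sigma)_Q^P\bigr)$, and $A(P)_1$ is identified with $A_1(P)$. Defect group. $P\le K$ is a $p$-subgroup that is a defect group of $b$, i.e. $b\in (A_1)_P^K$ and $\operatorname{Br}_P(b)\ne0$. Then $\bar b=\operatorname{Br}_P(b)$ is a primitive idempotent of $A_1(P)^{N_K(P)}$ that is central in $A_1(P)$. $N_H(P)_b$, $N_H(P)_{\bar b}$, $C_H(P)_{\bar b}$ are the stabilizers of $b$, respectively $\bar b$, in $N_H(P)$, respectively of $\bar b$ in $C_H(P)$; one has $N_H(P)_b=N_H(P)_{\bar b}$. $G_b$ is the stabilizer of $b$ in $G=H/K$ ($K$ fixes $b$). Extension (1). $G[b]=\{\sigma\in G_b\mid (bA_\sigma)^K\cdot(bA_{\sigma^{-1}})^K=(bA_1)^K\}$, a normal subgroup of $G_b$. $C=\bigoplus_{\sigma\in G[b]}C_\sigma$ with $C_\sigma=b(A_\sigma)^K$ is a crossed product of the local ring $C_1=bA_1^K$ with $G[b]$, and a $G_b$-algebra. Put $\bar C_1=C_1/J(C_1)$ (a skew field) and $\bar C=C/CJ(C_1)$, a crossed product of $\bar C_1$ with $G[b]$. Extension (2). $R=\bigoplus_{\tau\in C_H(P)/C_K(P)}R_\tau$ is the strongly $C_H(P)/C_K(P)$-graded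 algebra $R=A_1(P)\otimes_{kC_K(P)}kC_H(P)$, $R_\tau=A_1(P)\otimes x$ for $x\in\tau$, with multiplication $(a\otimes x)(a'\otimes y)=a(a')^{x^{-1}}\otimes xy$, on which $N_H(P)$ acts by $(a\otimes x)^h=a^h\otimes h^{-1}xh$; $R_1$ is identified with $A_1(P)$, and $\bar b$ is regarded as an element of $R_1$. Let $\overline{C_H(P)}[\bar b]=\{\tau\in C_H(P)_{\bar b}/C_K(P)\mid \bar b(R_\tau)^{N_K(P)}\cdot\bar b(R_{\tau^{-1}})^{N_K(P)}=\bar b(R_1)^{N_K(P)}\}$, a normal subgroup of $C_H(P)_{\bar b}/C_K(P)$, and $D=\bigoplus_{\tau\in\overline{C_H(P)}[\bar b]}D_\tau$ with $D_\tau=\bar b(R_\tau)^{N_K(P)}$. $D_1$ is local; put $\bar D_1=D_1/J(D_1)$ (a skew field) and $\bar D=D/DJ(D_1)$, an $N_H(P)_{\bar b}$-algebra which is a crossed product of $\bar D_1$ with $\overline{C_H(P)}[\bar b]$. The natural monomorphism $\overline{C_H(P)}[\bar b]\to G[b]$ is the one induced by $C_H(P)/C_K(P)\simeq C_H(P)K/K\le G$. Extension (3). $G[\bar b]=\{\sigma\in G_b\mid \bar bA(P)_\sigma^{N_K(P)}\cdot\bar bA(P)_{\sigma^{-1}}^{N_K(P)}=\bar bA(P)_1^{N_K(P)}\}$, a subgroup of $G_b$, and $E=\bigoplus_{\sigma\in G[\bar b]}E_\sigma$ with $E_\sigma=\bar bA(P)_\sigma^{N_K(P)}$. $E_1=\bar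 bA_1(P)^{N_K(P)}$ is local; put $\bar E_1=E_1/J(E_1)$ (a skew field) and $\bar E=E/EJ(E_1)$, an $N_H(P)_b$-algebra which is a crossed product of $\bar E_1$ with $G[\bar b]$. Further group. $\overline{N_H(P)}[\bar b]=\{\sigma\in N_H(P)_bK/K\mid \bar bA(P)_\sigma^{N_K(P)}\cdot\bar bA(P)_{\sigma^{-1}}^{N_K(P)}=\bar bA(P)_1^{N_K(P)}\}$. For a graded algebra $B$, $\operatorname{hU}(B)$ is the group of homogeneous units, and the map from it to the grading group is the degree map. The actions on the extensions are those induced by the actions of $H_b$ (the inverse image of $G_b$ in $H$) on $C$ and of $N_H(P)_b=N_H(P)_{\bar b}$ on $D$ and $E$; $K$, respectively $N_K(P)$, acts trivially on these algebras. *)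

(* Defs.v *)
From HB Require Import structures.
From mathcomp Require Import all_boot all_fingroup all_algebra.
From mathcomp Require Import boolp classical_sets.

Set Implicit Arguments.
Unset Strict Implicit.
Unset Printing Implicit Defensive.

Import GRing.Theory.
Local Open Scope quotient_scope.
Local Open Scope group_scope.
Local Open Scope ring_scope.

(* A unitary O-algebra is a ring with a central ring morphism from O.         *)
(* MathComp's [algType] is not used because it excludes the zero ring, which  *)
(* is a legitimate Brauer quotient.                                           *)
Record unitaryAlg (O : pzRingType) := UnitaryAlg {
  alg_ring :> pzRingType;
  alg_scal : {rmorphism O -> alg_ring};
  alg_scalC : forall c a, alg_scal c * a = a * alg_scal c
}.

Inductive span (V : zmodType) (S : set V) : V -> Prop :=
| SpanIn x of S x : span S x
| Span0 : span S 0
| SpanB x y of span S x & span S y : span S (x - y).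

Definition mulspan (A : pzRingType) (S T : set A) : set A :=
  span [set x | exists s t, [/\ S s, T t & x = s * t]]%classic.

Section Jacobson.
Variable R : pzRingType.
Implicit Type I : set R.

Definition left_ideal I :=
  [/\ I 0, forall x y, I x -> I y -> I (x - y) & forall a x, I x -> I (a * x)].

Definition maximal_left_ideal I :=
  [/\ left_ideal I, ~ I 1
    & forall I', left_ideal I' -> (I `<=` I')%classic -> ~ I' 1 -> I' = I].

Definition jacobson : set R :=
  [set x | forall I, maximal_left_ideal I -> I x]%classic.

Definition is_unit (x : R) := exists y, x * y = 1 /\ y * x = 1.

(* R / jacobson R is a skew field iff R is nonzero and its nonunits are       *)
(* closed under addition                                                      *)
Definition local_ring :=
  (1 : R) <> 0 /\ forall x y, is_unit (x + y) -> is_unit x \/ is_unit y.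

Lemma left_idealD I x y : left_ideal I -> I x -> I y -> I (x + y).
Proof.
by case=> I0 IB _ Ix Iy; rewrite -[y]opprK -[- y]sub0r; apply: (IB) => //; apply: IB.
Qed.

Lemma maximal_left_ideal_ex I0 : left_ideal I0 -> ~ I0 1 ->
  exists I, maximal_left_ideal I /\ (I0 `<=` I)%classic.
Proof.
move=> lI0 I01.
pose P (X : set R) := left_ideal (X `|` I0)%classic /\ ~ (X `|` I0)%classic 1.
have [|A [[lA A1] Amax]] := @Zorn_bigcup R P.
  move=> F FP Ftot; split; last first.
    by case=> [[X FX X1]|//]; case: (FP _ FX) => _; apply; left.
  have key x y : ((\bigcup_(X in F) X) `|` I0)%classic x ->
      ((\bigcup_(X in F) X) `|` I0)%classic y ->
      exists J, [/\ left_ideal J, J x, J y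
        & (J `<=` (\bigcup_(X in F) X) `|` I0)%classic].
    have sub X : F X -> ((X `|` I0) `<=` (\bigcup_(X in F) X) `|` I0)%classic.
      by move=> FX z [Xz|]; [left; exists X|right].
    case=> [[X FX Xx]|Ix]; case=> [[Y FY Yy]|Iy].
    - case: (Ftot X Y FX FY) => sXY.
      + exists (Y `|` I0)%classic; split; [by case: (FP _ FY)| | |exact: sub].
          by left; apply: sXY.
        by left.
      + exists (X `|` I0)%classic; split; [by case: (FP _ FX)| | |exact: sub].
          by left.
        by left; apply: sXY.
    - exists (X `|` I0)%classic; split; [by case: (FP _ FX)| | |exact: sub].
        by left.
      by right.
    - exists (Y `|` I0)%classic; split; [by case: (FP _ FY)| | |exact: sub].
        by right.
      by left.
    - by exists I0; split=> //; move=> z; right.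
  case: (lI0) => I00 I0B I0M; split.
  - by right.
  - move=> x y Hx Hy; have [J [[_ JB _] Jx Jy sJ]] := key _ _ Hx Hy.
    by apply: sJ; apply: JB.
  - move=> a x Hx; have [J [[_ _ JM] Jx _ sJ]] := key _ _ Hx Hx.
    by apply: sJ; apply: JM.
exists (A `|` I0)%classic; split; last by move=> x; right.
split=> // I' lI' sAI I'1; apply: contrapT => neq.
have sI0 : (I0 `<=` I')%classic by move=> x Ix; apply: sAI; right.
have E : (I' `|` I0)%classic = I' by apply/setUidPl.
have PI' : P I' by rewrite /P E.
apply: (Amax I') => //; rewrite properEneq; split.
  by apply/eqP=> EA; apply: neq; rewrite EA E.
by move=> x Ax; apply: sAI; left.
Qed.

Lemma jacobsonP x :
  jacobson x <-> forall a, exists u, u * (1 - a * x) = 1.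
Proof.
split=> [Jx a | H I [lI I1 Imax]].
  apply: contrapT => nu.
  pose L : set R := [set y | exists r, y = r * (1 - a * x)]%classic.
  have lL : left_ideal L.
    split; first by exists 0; rewrite mul0r.
      by move=> _ _ [r ->] [s ->]; exists (r - s); rewrite mulrBl.
    by move=> b _ [r ->]; exists (b * r); rewrite mulrA.
  have [|I [mI sLI]] := maximal_left_ideal_ex lL.
    by case=> r E; apply: nu; exists r.
  case: (mI) => lI I1 _; apply: I1; have -> : 1 = (1 - a * x) + a * x by rewrite subrK.
  apply: left_idealD => //; first by apply: sLI; exists 1; rewrite mul1r.
  by case: lI => _ _; apply; apply: Jx.
apply: contrapT => Ix.
case: (lI) => I0 IB IM.
pose L : set R := [set y | exists a z, I z /\ y = a * x + z]%classic.
have lL : left_ideal L.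
  split; first by exists 0, 0; rewrite mul0r addr0.
    move=> _ _ [a [z [Iz ->]]] [b [t [It ->]]]; exists (a - b), (z - t).
    by split; [exact: IB|rewrite mulrBl opprD addrACA].
  move=> b _ [a [z [Iz ->]]]; exists (b * a), (b * z).
  by split; [exact: IM|rewrite mulrDr mulrA].
have sIL : (I `<=` L)%classic by move=> z Iz; exists 0, z; rewrite mul0r add0r.
have Lx : L x by exists 1, 0; rewrite mul1r addr0.
have [a [z [Iz E]]] : L 1.
  apply: contrapT => L1; apply: Ix.
  by rewrite -(Imax _ lL sIL L1).
have [u uE] := H a; apply: I1.
have zE : 1 - a * x = z by rewrite {1}E addrAC subrr add0r.
by rewrite -uE; apply: IM; rewrite zE.
Qed.

Lemma jacobson0 : jacobson 0.
Proof. by move=> I [[]]. Qed.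

Lemma jacobsonB x y : jacobson x -> jacobson y -> jacobson (x - y).
Proof.
by move=> Jx Jy I mI; case: (mI) => -[_ IB _] _ _; apply: IB; [apply: Jx|apply: Jy].
Qed.

Lemma jacobsonMl a x : jacobson x -> jacobson (a * x).
Proof. by move=> Jx I mI; case: (mI) => -[_ _ IM] _ _; apply: IM; apply: Jx. Qed.

End Jacobson.

(* An algebra with a right action a ^ h = [act a h] of a group X by algebra   *)
(* automorphisms; [act] is only meaningful on elements of X.                  *)
Record actAlg (O : pzRingType) (gT : finGroupType) (X : {group gT}) := ActAlg {
  act_alg :> unitaryAlg O;
  act : act_alg -> gT -> act_alg;
  actD : forall a b h, h \in X -> act (a + b) h = act a h + act b h;
  actMr : forall a b h, h \in X -> act (a * b) h = act a h * act b h;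
  act_scal : forall c h, h \in X -> act (alg_scal act_alg c) h = alg_scal act_alg c;
  act_one : forall h, h \in X -> act 1 h = 1;
  act1g : forall a, act a 1%g = a;
  actMg : forall a h h', h \in X -> h' \in X ->
    act a (h * h')%g = act (act a h) h'
}.

Section ActTheory.
Variables (O : pzRingType) (gT : finGroupType) (X : {group gT}) (A : actAlg O X).
Implicit Types (a b : A) (h : gT).

Lemma act0 h : h \in X -> act (0 : A) h = 0.
Proof. by move=> hX; apply: (addIr (act (0 : A) h)); rewrite -actD ?addr0 ?add0r. Qed.

Lemma actN a h : h \in X -> act (- a) h = - act a h.
Proof. by move=> hX; apply: (addIr (act a h)); rewrite -actD // !addNr act0. Qed.

Lemma actB a b h : h \in X -> act (a - b) h = act a h - act b h.
Proof. by move=> hX; rewrite actD ?actN. Qed.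

Lemma actK a h : h \in X -> act (act a h) h^-1%g = a.
Proof. by move=> hX; rewrite -actMg ?groupV // mulgV act1g. Qed.

Lemma actKV a h : h \in X -> act (act a h^-1%g) h = a.
Proof. by move=> hX; rewrite -actMg ?groupV // mulVg act1g. Qed.

Lemma act_sum (I : Type) (r : seq I) (P : pred I) (F : I -> A) h : h \in X ->
  act (\sum_(i <- r | P i) F i) h = \sum_(i <- r | P i) act (F i) h.
Proof.
move=> hX; apply: (big_morph (fun a => act a h)) => [a b|]; first exact: actD.
exact: act0.
Qed.

Definition fixed (Q : {set gT}) : set A :=
  [set a | forall q, q \in Q -> act a q = a]%classic.

Definition stab (N : {set gT}) (a : A) : {set gT} :=
  [set h in N | act a h == a].

Lemma stab_group_set (N : {group gT}) a : N \subset X -> group_set (stab N a).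
Proof.
move=> /fintype.subsetP sNX; apply/group_setP; split; first by rewrite inE group1 act1g eqxx.
move=> x y; rewrite !inE => /andP[xN /eqP ax] /andP[yN /eqP ay].
by rewrite groupM //= actMg ?sNX // ax ay.
Qed.

Definition reltr (Q P : {set gT}) (a : A) : A :=
  \sum_(C in rcosets Q P) act a (repr C).

Definition trimg (Q P : {set gT}) : set A :=
  [set x | exists2 a, fixed Q a & x = reltr Q P a]%classic.

Record stable_subalg (N : {group gT}) := StableSubalg {
  sa_carrier :> A -> Prop;
  sa_one : A;
  sa_sub : N \subset X;
  saB : forall x y, sa_carrier x -> sa_carrier y -> sa_carrier (x - y);
  saM : forall x y, sa_carrier x -> sa_carrier y -> sa_carrier (x * y);
  saZ : forall c x, sa_carrier x -> sa_carrier (alg_scal A c * x);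
  sa1 : sa_carrier sa_one;
  sa1M : forall x, sa_carrier x -> sa_one * x = x;
  saM1 : forall x, sa_carrier x -> x * sa_one = x;
  sa_act : forall x h, h \in N -> sa_carrier x -> sa_carrier (act x h);
  sa_act1 : forall h, h \in N -> act sa_one h = sa_one
}.

Record stable_ideal := StableIdeal {
  si_carrier :> A -> Prop;
  si0 : si_carrier 0;
  siB : forall x y, si_carrier x -> si_carrier y -> si_carrier (x - y);
  siMl : forall a x, si_carrier x -> si_carrier (a * x);
  siMr : forall a x, si_carrier x -> si_carrier (x * a);
  si_act : forall x h, h \in X -> si_carrier x -> si_carrier (act x h)
}.

End ActTheory.

Arguments act {O gT X _} _ _%_g.

Section Subalg.
Variables (O : pzRingType) (gT : finGroupType) (X : {group gT}) (A : actAlg O X).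
Variables (N : {group gT}) (S : stable_subalg A N).

(* S as a ring of its own, with identity element [sa_one S] *)
Definition sub_type := {x : A | `[< S x >]}.
HB.instance Definition _ := Choice.on sub_type.

Definition sub_in (x : A) (Sx : S x) : sub_type := exist _ x (asboolT Sx).

Lemma sub_valP (u : sub_type) : S (val u).
Proof. exact/asboolP/(valP u). Qed.

Let sa0 : S 0. Proof. by rewrite -(subrr (sa_one S)); apply: saB; apply: sa1. Qed.
Let saN x : S x -> S (- x). Proof. by move=> Sx; rewrite -sub0r; apply: saB. Qed.
Let saD x y : S x -> S y -> S (x + y).
Proof. by move=> Sx Sy; rewrite -[y]opprK; apply: saB => //; apply: saN. Qed.

Definition sub0 : sub_type := sub_in sa0.
Definition subN (u : sub_type) : sub_type := sub_in (saN (sub_valP u)).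
Definition subD (u v : sub_type) : sub_type := sub_in (saD (sub_valP u) (sub_valP v)).
Definition sub1 : sub_type := sub_in (sa1 S).
Definition subM (u v : sub_type) : sub_type := sub_in (saM (sub_valP u) (sub_valP v)).
Definition sub_scal (c : O) : sub_type := sub_in (saZ c (sa1 S)).

Let subDA : associative subD. Proof. by move=> *; apply: val_inj; apply: addrA. Qed.
Let subDC : commutative subD. Proof. by move=> *; apply: val_inj; apply: addrC. Qed.
Let sub0D : left_id sub0 subD. Proof. by move=> *; apply: val_inj; apply: add0r. Qed.
Let subND : left_inverse sub0 subN subD.
Proof. by move=> *; apply: val_inj; apply: addNr. Qed.
HB.instance Definition _ := GRing.isZmodule.Build sub_type subDA subDC sub0D subND.

Let subMA : associative subM. Proof. by move=> *; apply: val_inj; apply: mulrA. Qed.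
Let sub1M : left_id sub1 subM.
Proof. by move=> u; apply: val_inj; apply: sa1M; apply: sub_valP. Qed.
Let subM1 : right_id sub1 subM.
Proof. by move=> u; apply: val_inj; apply: saM1; apply: sub_valP. Qed.
Let subMDl : left_distributive subM +%R.
Proof. by move=> *; apply: val_inj; apply: mulrDl. Qed.
Let subMDr : right_distributive subM +%R.
Proof. by move=> *; apply: val_inj; apply: mulrDr. Qed.
HB.instance Definition _ :=
  GRing.Zmodule_isPzRing.Build sub_type subMA sub1M subM1 subMDl subMDr.

Let sub_scalB : GRing.zmod_morphism sub_scal.
Proof. by move=> c d; apply: val_inj; rewrite /= rmorphB mulrBl. Qed.
Let sub_scalM : GRing.monoid_morphism sub_scal.
Proof.
split=> [|c d]; apply: val_inj; rewrite /= ?rmorph1 ?mul1r //.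
rewrite rmorphM -!mulrA; congr (_ * _).
by rewrite mulrA -alg_scalC -mulrA sa1M //; apply: sa1.
Qed.
HB.instance Definition _ := GRing.isZmodMorphism.Build O sub_type sub_scal sub_scalB.
HB.instance Definition _ := GRing.isMonoidMorphism.Build O sub_type sub_scal sub_scalM.

Let sub_scalC c (u : sub_type) : sub_scal c * u = u * sub_scal c.
Proof.
apply: val_inj; have Su := sub_valP u.
by rewrite /= -mulrA sa1M // mulrA -alg_scalC -mulrA saM1.
Qed.

Definition sub_ring : unitaryAlg O := UnitaryAlg sub_scalC.

Definition sub_act (u : sub_type) (h : gT) : sub_type := insubd u (act (val u) h).

Lemma val_sub_act u h : h \in N -> val (sub_act u h) = act (val u) h.
Proof.
move=> hN; rewrite /sub_act insubdK //; apply/asboolP.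
by apply: sa_act => //; apply: sub_valP.
Qed.

Let sNX h : h \in N -> h \in X. Proof. exact: (fintype.subsetP (sa_sub S)). Qed.

Let sub_actD u v h : h \in N -> sub_act (u + v) h = sub_act u h + sub_act v h.
Proof. by move=> hN; apply: val_inj; rewrite /= !val_sub_act //= actD // sNX. Qed.
Let sub_actMr u v h : h \in N -> sub_act (u * v) h = sub_act u h * sub_act v h.
Proof. by move=> hN; apply: val_inj; rewrite /= !val_sub_act //= actMr // sNX. Qed.
Let sub_act_scal c h : h \in N -> sub_act (sub_scal c) h = sub_scal c.
Proof.
move=> hN; apply: val_inj.
by rewrite /= !val_sub_act //= actMr ?act_scal ?sa_act1 // sNX.
Qed.
Let sub_act_one h : h \in N -> sub_act 1 h = 1.
Proof. by move=> hN; apply: val_inj; rewrite /= !val_sub_act //= sa_act1. Qed.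
Let sub_act1g u : sub_act u 1%g = u.
Proof. by apply: val_inj; rewrite /= !val_sub_act //= act1g. Qed.
Let sub_actMg u h h' : h \in N -> h' \in N ->
  sub_act u (h * h')%g = sub_act (sub_act u h) h'.
Proof.
by move=> hN hN'; apply: val_inj; rewrite /= !val_sub_act ?groupM //= actMg // sNX.
Qed.

Definition subAlg : actAlg O N :=
  @ActAlg O gT N sub_ring sub_act sub_actD sub_actMr sub_act_scal sub_act_one
    sub_act1g sub_actMg.

End Subalg.

Section Quotient.
Variables (O : pzRingType) (gT : finGroupType) (X : {group gT}) (A : actAlg O X).
Variable I : stable_ideal A.

Definition quot_eq (x y : A) : bool := `[< I (x - y) >].

Let quot_eq_refl : reflexive quot_eq.
Proof. by move=> x; apply/asboolP; rewrite subrr; apply: si0. Qed.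
Let siN x : I x -> I (- x).
Proof. by move=> Ix; rewrite -sub0r; apply: siB => //; apply: si0. Qed.
Let siD x y : I x -> I y -> I (x + y).
Proof. by move=> Ix Iy; rewrite -[y]opprK; apply: siB => //; apply: siN. Qed.
Let quot_eq_sym : symmetric quot_eq.
Proof. by move=> x y; apply/asboolP/asboolP => /siN; rewrite opprB. Qed.
Let quot_eq_trans : transitive quot_eq.
Proof.
move=> y x z /asboolP Ixy /asboolP Iyz; apply/asboolP.
by rewrite -(subrK y x) -addrA; apply: siD.
Qed.

Canonical quot_equiv := EquivRel quot_eq quot_eq_refl quot_eq_sym quot_eq_trans.

Definition quot_type := {eq_quot quot_eq}.
HB.instance Definition _ := Choice.on quot_type.
HB.instance Definition _ := EqQuotient.on quot_type.

Definition quot_pi (x : A) : quot_type := \pi_quot_type x.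

Lemma quot_piE x y : quot_pi x = quot_pi y <-> I (x - y).
Proof. by split=> [/eqmodP/asboolP|H]; [|apply/eqmodP/asboolP]. Qed.

Lemma quot_repr x : I (generic_quotient.repr (quot_pi x) - x).
Proof. by apply/quot_piE; rewrite /quot_pi reprK. Qed.

Lemma quot_ind (P : quot_type -> Prop) : (forall x, P (quot_pi x)) -> forall q, P q.
Proof. by move=> H q; rewrite -[q]reprK; apply: H. Qed.

Definition quot0 : quot_type := quot_pi 0.
Definition quotN (q : quot_type) : quot_type := quot_pi (- generic_quotient.repr q).
Definition quotD (q r : quot_type) : quot_type := quot_pi (generic_quotient.repr q + generic_quotient.repr r).
Definition quot1 : quot_type := quot_pi 1.
Definition quotM (q r : quot_type) : quot_type := quot_pi (generic_quotient.repr q * generic_quotient.repr r).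
Definition quot_scal (c : O) : quot_type := quot_pi (alg_scal A c).
Definition quot_act (q : quot_type) (h : gT) : quot_type := quot_pi (act (generic_quotient.repr q) h).

Lemma quot_piN x : quotN (quot_pi x) = quot_pi (- x).
Proof. by apply/quot_piE; rewrite opprK addrC -opprB; apply: siN; apply: quot_repr. Qed.
Lemma quot_piD x y : quotD (quot_pi x) (quot_pi y) = quot_pi (x + y).
Proof.
by apply/quot_piE; rewrite opprD addrACA; apply: siD; apply: quot_repr.
Qed.
Lemma quot_piM x y : quotM (quot_pi x) (quot_pi y) = quot_pi (x * y).
Proof.
apply/quot_piE; set x' := generic_quotient.repr _; set y' := generic_quotient.repr _.
have -> : x' * y' - x * y = (x' - x) * y' + x * (y' - y).
  by rewrite mulrBl mulrBr addrA subrK.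
by apply: siD; [apply: siMr|apply: siMl]; apply: quot_repr.
Qed.
Lemma quot_pi_act x h : h \in X -> quot_act (quot_pi x) h = quot_pi (act x h).
Proof. by move=> hX; apply/quot_piE; rewrite -actB //; apply: si_act => //; apply: quot_repr. Qed.

Let quotDA : associative quotD.
Proof. by do 3![elim/quot_ind=> ?]; rewrite !quot_piD addrA. Qed.
Let quotDC : commutative quotD.
Proof. by do 2![elim/quot_ind=> ?]; rewrite !quot_piD addrC. Qed.
Let quot0D : left_id quot0 quotD.
Proof. by elim/quot_ind=> ?; rewrite !quot_piD add0r. Qed.
Let quotND : left_inverse quot0 quotN quotD.
Proof. by elim/quot_ind=> ?; rewrite quot_piN !quot_piD addNr. Qed.
HB.instance Definition _ := GRing.isZmodule.Build quot_type quotDA quotDC quot0D quotND.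

Let quotMA : associative quotM.
Proof. by do 3![elim/quot_ind=> ?]; rewrite !quot_piM mulrA. Qed.
Let quot1M : left_id quot1 quotM.
Proof. by elim/quot_ind=> ?; rewrite !quot_piM mul1r. Qed.
Let quotM1 : right_id quot1 quotM.
Proof. by elim/quot_ind=> ?; rewrite !quot_piM mulr1. Qed.
Let quotMDl : left_distributive quotM quotD.
Proof.
elim/quot_ind=> x; elim/quot_ind=> y; elim/quot_ind=> z.
by rewrite (quot_piD x y) !quot_piM quot_piD mulrDl.
Qed.
Let quotMDr : right_distributive quotM quotD.
Proof.
elim/quot_ind=> x; elim/quot_ind=> y; elim/quot_ind=> z.
by rewrite (quot_piD y z) !quot_piM quot_piD mulrDr.
Qed.
HB.instance Definition _ :=
  GRing.Zmodule_isPzRing.Build quot_type quotMA quot1M quotM1 quotMDl quotMDr.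

Let quot_scalB : GRing.zmod_morphism quot_scal.
Proof. by move=> c d; rewrite /quot_scal rmorphB -quot_piD -quot_piN. Qed.
Let quot_scalM : GRing.monoid_morphism quot_scal.
Proof. by split=> [|c d]; rewrite /quot_scal ?rmorph1 // rmorphM -quot_piM. Qed.
HB.instance Definition _ :=
  GRing.isZmodMorphism.Build O quot_type quot_scal quot_scalB.
HB.instance Definition _ :=
  GRing.isMonoidMorphism.Build O quot_type quot_scal quot_scalM.

Let quot_scalC c (q : quot_type) : quot_scal c * q = q * quot_scal c.
Proof. by elim/quot_ind: q => x; rewrite [LHS]quot_piM [RHS]quot_piM alg_scalC. Qed.

Definition quot_ring : unitaryAlg O := UnitaryAlg quot_scalC.

Let quot_actD (q r : quot_type) h : h \in X ->
  quot_act (q + r) h = quot_act q h + quot_act r h.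
Proof.
elim/quot_ind: q => x; elim/quot_ind: r => y hX.
by rewrite [_ + _ in LHS]quot_piD !quot_pi_act // [RHS]quot_piD actD.
Qed.
Let quot_actMr (q r : quot_type) h : h \in X ->
  quot_act (q * r) h = quot_act q h * quot_act r h.
Proof.
elim/quot_ind: q => x; elim/quot_ind: r => y hX.
by rewrite [_ * _ in LHS]quot_piM !quot_pi_act // [RHS]quot_piM actMr.
Qed.
Let quot_act_scal c h : h \in X -> quot_act (quot_scal c) h = quot_scal c.
Proof. by move=> hX; rewrite /quot_scal quot_pi_act // act_scal. Qed.
Let quot_act_one h : h \in X -> quot_act 1 h = 1.
Proof. by move=> hX; rewrite quot_pi_act // act_one. Qed.
Let quot_act1g q : quot_act q 1%g = q.
Proof. by elim/quot_ind: q => x; rewrite quot_pi_act ?act1g. Qed.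
Let quot_actMg q h h' : h \in X -> h' \in X ->
  quot_act q (h * h')%g = quot_act (quot_act q h) h'.
Proof.
by elim/quot_ind: q => x hX hX'; rewrite !quot_pi_act ?groupM ?actMg.
Qed.

Definition quotAlg : actAlg O X :=
  @ActAlg O gT X quot_ring quot_act quot_actD quot_actMr quot_act_scal quot_act_one
    quot_act1g quot_actMg.

Lemma quot_piB x y :
  (quot_pi (x - y) : quotAlg) = (quot_pi x : quotAlg) - quot_pi y.
Proof. by rewrite -[RHS]/(quotD _ (quotN _)) quot_piN quot_piD. Qed.

End Quotient.
(* A K-interior H-algebra, K normal in H: [ia_int y] is y . 1 for y in K.     *)
Record interiorAlg (O : pzRingType) (gT : finGroupType) (K H : {group gT}) :=
  InteriorAlg {
  ia_alg :> actAlg O H;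
  ia_int : gT -> ia_alg;
  ia_normal : K <| H;
  ia_int1 : ia_int 1%g = 1;
  ia_intM : forall y z, y \in K -> z \in K -> ia_int (y * z)%g = ia_int y * ia_int z;
  ia_intJ : forall y h, y \in K -> h \in H -> act (ia_int y) h = ia_int (y ^ h)%g;
  ia_actE : forall y a, y \in K -> act a y = ia_int y^-1%g * a * ia_int y
}.

Arguments ia_int {O gT K H _} _%_g.

Section Brauer.
Variables (O k : pzRingType) (res : {rmorphism O -> k}).
Variables (gT : finGroupType) (K H : {group gT}) (A : interiorAlg O K H).
Variables (P : {group gT}) (sPH : P \subset H).

Let inH x : x \in P -> x \in H. Proof. exact: (fintype.subsetP sPH). Qed.
Let sNH : 'N_H(P) \subset H. Proof. exact: subsetIl. Qed.
Let NH h : h \in 'N_H(P) -> h \in H. Proof. exact: (fintype.subsetP sNH). Qed.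

Let fixedB x y : fixed P x -> fixed P y -> @fixed _ _ _ A P (x - y).
Proof. by move=> Fx Fy q qP; rewrite actB ?inH // Fx // Fy. Qed.
Let fixedM x y : fixed P x -> fixed P y -> @fixed _ _ _ A P (x * y).
Proof. by move=> Fx Fy q qP; rewrite actMr ?inH // Fx // Fy. Qed.
Let fixedZ c x : fixed P x -> @fixed _ _ _ A P (alg_scal A c * x).
Proof. by move=> Fx q qP; rewrite actMr ?inH // act_scal ?inH // Fx. Qed.
Let fixed1 : @fixed _ _ _ A P 1.
Proof. by move=> q qP; rewrite act_one ?inH. Qed.
Let fixed_act x h : h \in 'N_H(P) -> fixed P x -> @fixed _ _ _ A P (act x h).
Proof.
move=> hN Fx q qP; have hH := NH hN.
have qhP : (q ^ h^-1)%g \in P by rewrite memJ_norm // groupV; case/setIP: hN.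
by rewrite -(actMg _ hH (inH qP)) conjgCV (actMg _ (inH qhP) hH) Fx.
Qed.
Let act1N h : h \in 'N_H(P) -> act (1 : A) h = 1.
Proof. by move/NH/act_one. Qed.

Definition fixedSubalg : stable_subalg A 'N_H(P) :=
  @StableSubalg _ _ _ A 'N_H(P)%G (fixed P) 1 sNH fixedB fixedM fixedZ fixed1
    (fun x _ => mul1r x) (fun x _ => mulr1 x) fixed_act act1N.

Definition fixedAlg := subAlg fixedSubalg.

(* As J(O) is the kernel of the residue map res : O -> k, the algebra         *)
(* k (x) (A^P / sum_(Q < P) A_Q^P) is A^P modulo sum_(Q < P) A_Q^P + J(O) A^P *)
Definition brauer_gen : set A :=
  [set x | (exists Q : {group gT}, Q \proper P /\ trimg Q P x) \/
           (exists c a, [/\ res c = 0, fixed P a & x = alg_scal A c * a])]%classic.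

Definition brauer_set (u : fixedAlg) : Prop := span brauer_gen (val u).

Lemma act_rcoset (Q : {group gT}) (a : A) C x : Q \subset P -> fixed Q a ->
  C \in rcosets Q P -> x \in C -> act a (repr C) = act a x.
Proof.
move=> sQP Fa /rcosetsP[y yP ->] xC.
have xP : x \in P by case/rcosetP: xC => q qQ ->; rewrite groupM // (fintype.subsetP sQP).
rewrite -(rcoset_eqP xC); case: repr_rcosetP => q qQ.
by rewrite (actMg _ (inH (fintype.subsetP sQP _ qQ)) (inH xP)) Fa.
Qed.

Lemma reltr_act (Q : {group gT}) (a : A) h : h \in 'N_H(P) -> Q \subset P ->
  fixed Q a -> act (reltr Q P a) h = reltr (Q :^ h) P (act a h).
Proof.
move=> hN sQP Fa; have hH := NH hN; have hNP : h \in 'N(P) by case/setIP: hN.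
rewrite /reltr act_sum //.
rewrite (reindex_onto (fun C => C :^ h^-1)%g (fun C => C :^ h)%g) /=; last first.
  by move=> C _; rewrite conjsgK.
have sQhP : Q :^ h \subset P by rewrite -(normP hNP) conjSg.
have Fah : fixed (Q :^ h) (act a h).
  move=> _ /imsetP[q qQ ->].
  have qH : q \in H by rewrite inH // (fintype.subsetP sQP).
  by rewrite -(actMg _ hH (groupJ qH hH)) -conjgC (actMg _ qH hH) Fa.
apply: eq_big => [C|C].
  rewrite conjsgKV eqxx andbT; apply/rcosetsP/rcosetsP => -[x xP E].
    exists (x ^ h)%g; first by rewrite memJ_norm.
    by rewrite -[C](conjsgKV h) E conjsMg conjg_set1.
  exists (x ^ h^-1)%g; first by rewrite memJ_norm // groupV.
  by rewrite E conjsMg conjg_set1 conjsgK.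
case/andP=> CR _.
have [x xP E] := rcosetsP CR.
have xH : x \in H by rewrite inH.
have xC : x \in (C :^ h^-1)%g by rewrite E rcoset_refl.
rewrite (act_rcoset sQP Fa CR xC).
have CR' : C \in rcosets (Q :^ h) P.
  apply/rcosetsP; exists (x ^ h)%g; first by rewrite memJ_norm.
  by rewrite -[C](conjsgKV h) E conjsMg conjg_set1.
have xC' : (x ^ h)%g \in C by rewrite -[C](conjsgKV h) memJ_conjg.
rewrite (act_rcoset (Q := (Q :^ h)%G) sQhP Fah CR' xC').
by rewrite -(actMg _ xH hH) -(actMg _ hH (groupJ xH hH)) -conjgC.
Qed.

Let br0 : brauer_set 0. Proof. exact: Span0. Qed.
Let brB u v : brauer_set u -> brauer_set v -> brauer_set (u - v).
Proof. exact: SpanB. Qed.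

Let brMl u v : brauer_set v -> brauer_set (u * v).
Proof.
have Fu := sub_valP u; rewrite /brauer_set /=; elim=> [x|| x y _ IHx _ IHy].
- case=> [[Q [pQP [a Fa ->]]]|[c [a [c0 Fa ->]]]]; apply: SpanIn; last first.
    right; exists c, (val u * a); split=> //; first exact: fixedM.
    by rewrite mulrA -alg_scalC mulrA.
  have sQP := proper_sub pQP.
  left; exists Q; split=> //; exists (val u * a).
    move=> q qQ; have qP : q \in P by exact: (fintype.subsetP sQP).
    by rewrite actMr ?inH // Fu // Fa.
  rewrite /reltr mulr_sumr; apply: eq_bigr => C /rcosetsP[y yP ->].
  have rP : repr (Q :* y)%g \in P.
    by case: repr_rcosetP => q qQ; rewrite groupM // (fintype.subsetP sQP).
  by rewrite actMr ?inH // Fu.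
- by rewrite mulr0; exact: Span0.
- by rewrite mulrBr; exact: SpanB.
Qed.

Let brMr u v : brauer_set v -> brauer_set (v * u).
Proof.
have Fu := sub_valP u; rewrite /brauer_set /=; elim=> [x|| x y _ IHx _ IHy].
- case=> [[Q [pQP [a Fa ->]]]|[c [a [c0 Fa ->]]]]; apply: SpanIn; last first.
    right; exists c, (a * val u); split=> //; first exact: fixedM.
    by rewrite mulrA.
  have sQP := proper_sub pQP.
  left; exists Q; split=> //; exists (a * val u).
    move=> q qQ; have qP : q \in P by exact: (fintype.subsetP sQP).
    by rewrite actMr ?inH // Fu // Fa.
  rewrite /reltr mulr_suml; apply: eq_bigr => C /rcosetsP[y yP ->].
  have rP : repr (Q :* y)%g \in P.
    by case: repr_rcosetP => q qQ; rewrite groupM // (fintype.subsetP sQP).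
  by rewrite actMr ?inH // Fu.
- by rewrite mul0r; exact: Span0.
- by rewrite mulrBl; exact: SpanB.
Qed.

Let br_act u h : h \in 'N_H(P) -> brauer_set u -> brauer_set (act u h).
Proof.
move=> hN; rewrite /brauer_set val_sub_act //; have hH := NH hN.
elim=> [x|| x y _ IHx _ IHy].
- case=> [[Q [pQP [a Fa ->]]]|[c [a [c0 Fa ->]]]]; apply: SpanIn; last first.
    right; exists c, (act a h); split=> //; first exact: fixed_act.
    by rewrite actMr // act_scal.
  have sQP := proper_sub pQP; have hNP : h \in 'N(P) by case/setIP: hN.
  left; exists (Q :^ h)%G; split; first by rewrite -(normP hNP) properJ.
  exists (act a h); last by rewrite reltr_act.
  move=> _ /imsetP[q qQ ->].
  have qH : q \in H by rewrite inH // (fintype.subsetP sQP).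
  by rewrite -(actMg _ hH (groupJ qH hH)) -conjgC (actMg _ qH hH) Fa.
- by rewrite act0 //; exact: Span0.
- by rewrite actB //; exact: SpanB.
Qed.

Definition brauerIdeal : stable_ideal fixedAlg :=
  @StableIdeal _ _ _ fixedAlg brauer_set br0 brB brMl brMr br_act.

Definition brauerAct := quotAlg brauerIdeal.

(* Br_P : A^P -> A(P), extended by 0 outside A^P *)
Definition Br (a : A) : brauerAct := quot_pi brauerIdeal (insubd (0 : sub_type _) a).

Lemma BrE (u : fixedAlg) : Br (val u) = quot_pi brauerIdeal u.
Proof. by rewrite /Br valKd. Qed.

Lemma BrM x y : fixed P x -> fixed P y -> Br (x * y) = Br x * Br y.
Proof.
move=> Fx Fy.
rewrite -[x]/(val (sub_in (S := fixedSubalg) Fx)) -[y]/(val (sub_in (S := fixedSubalg) Fy)).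
by rewrite !BrE [RHS]quot_piM -BrE.
Qed.

Lemma BrB x y : fixed P x -> fixed P y -> Br (x - y) = Br x - Br y.
Proof.
move=> Fx Fy.
rewrite -[x]/(val (sub_in (S := fixedSubalg) Fx)) -[y]/(val (sub_in (S := fixedSubalg) Fy)).
by rewrite !BrE [- quot_pi _ _]quot_piN [RHS]quot_piD -BrE.
Qed.

Lemma Br_act x h : h \in 'N_H(P) -> fixed P x -> act (Br x) h = Br (act x h).
Proof.
move=> hN Fx; rewrite -[x]/(val (sub_in (S := fixedSubalg) Fx)).
rewrite -val_sub_act // !BrE; exact: quot_pi_act.
Qed.

Lemma Br1 : Br 1 = 1.
Proof. exact: (BrE 1). Qed.

Lemma Br_scal c : Br (alg_scal A c) = alg_scal brauerAct c.
Proof.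
rewrite -[alg_scal A c]mulr1 -[_ * 1]/(val (sub_scal fixedSubalg c)); exact: BrE.
Qed.

Lemma Br_surj (q : brauerAct) : exists2 x, fixed P x & q = Br x.
Proof.
elim/quot_ind: q => u; exists (val u); last by rewrite BrE.
exact: (sub_valP (S := fixedSubalg) u).
Qed.

Let sKH : K \subset H. Proof. exact: normal_sub (ia_normal A). Qed.
Let KH x : x \in K -> x \in H. Proof. exact: (fintype.subsetP sKH). Qed.

Let CK y : y \in 'C_K(P) -> y \in K. Proof. by case/setIP. Qed.

Lemma fixed_int y : y \in 'C_K(P) -> fixed P (ia_int y : A).
Proof.
case/setIP=> yK /centP cy q qP; rewrite ia_intJ ?inH //.
by congr ia_int; apply/conjg_fixP/commgP; apply: cy.
Qed.

Let cent_normal : 'C_K(P) <| 'N_H(P).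
Proof.
have nKH := normal_norm (ia_normal A).
apply/andP; split; first exact: finset.setISS sKH (cent_sub _).
apply: normsI; first exact: fintype.subset_trans (finset.subsetIl _ _) nKH.
by apply: norms_cent; exact: finset.subsetIr.
Qed.

Let br_intM y z : y \in 'C_K(P) -> z \in 'C_K(P) ->
  Br (ia_int (y * z)) = Br (ia_int y) * Br (ia_int z).
Proof. by move=> yC zC; rewrite ia_intM ?BrM ?CK //; apply: fixed_int. Qed.

Let br_intJ y h : y \in 'C_K(P) -> h \in 'N_H(P) ->
  act (Br (ia_int y)) h = Br (ia_int (y ^ h)).
Proof.
move=> yC hN; rewrite Br_act //; last exact: fixed_int.
by rewrite ia_intJ ?CK ?NH.
Qed.

Let br_actE y a : y \in 'C_K(P) ->
  act a y = Br (ia_int y^-1) * a * Br (ia_int y).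
Proof.
move=> yC; have [x Fx ->] := Br_surj a.
have yN : y \in 'N_H(P) by exact: (fintype.subsetP (normal_sub cent_normal)).
have Fy := fixed_int yC.
have Fy' : fixed P (ia_int y^-1 : A) by apply: fixed_int; rewrite groupV.
by rewrite Br_act // ia_actE ?CK // !BrM //; apply: fixedM.
Qed.

Let br_int1 : Br (ia_int 1) = 1.
Proof. by rewrite ia_int1 Br1. Qed.

(* A(P), as a C_K(P)-interior N_H(P)-algebra *)
Definition brauer : interiorAlg O 'C_K(P) 'N_H(P) :=
  @InteriorAlg O gT 'C_K(P)%G 'N_H(P)%G brauerAct (fun y => Br (ia_int y))
    cent_normal br_int1 br_intM br_intJ br_actE.

End Brauer.

Section SkewAlgebra.
Variables (O : pzRingType) (gT : finGroupType) (L X : {group gT}).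
Variables (B : interiorAlg O L X) (M : {group gT}) (nMX : M <| X).

Let MX x : x \in M -> x \in X. Proof. exact: (fintype.subsetP (normal_sub nMX)). Qed.

(* B (x)_O OM with (a (x) x)(a' (x) y) = a a'^(x^-1) (x) xy; the function f    *)
(* stands for the sum of the f x (x) x                                        *)
Definition skew_type of M <| X := {ffun subg_of M -> B}.
Local Notation skew := (skew_type nMX).
HB.instance Definition _ := GRing.Zmodule.on skew.

Definition skew_pure (a : B) (x : gT) : skew :=
  [ffun z => if z == subg M x then a else 0].

Definition skew1 : skew := skew_pure 1 1%g.
Definition skewM (f g : skew) : skew :=
  [ffun z : subg_of M =>
    \sum_(x : subg_of M) f x * act (g (x^-1 * z)%g) (sgval x)^-1%g].
Definition skew_scal (c : O) : skew := skew_pure (alg_scal B c) 1%g.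
Definition skew_act (f : skew) (h : gT) : skew :=
  [ffun z : subg_of M => act (f (subg M (sgval z ^ h^-1)%g)) h].

Let mX (x : subg_of M) : sgval x \in X. Proof. exact: MX (subgP x). Qed.
Let mXV (x : subg_of M) : (sgval x)^-1%g \in X. Proof. by rewrite groupV. Qed.

Let skewMA : associative skewM.
Proof.
move=> f g h; apply/ffunP=> z; rewrite !ffunE.
under eq_bigr => x _ do rewrite ffunE act_sum ?mXV // mulr_sumr.
rewrite exchange_big /=.
under [RHS]eq_bigr => x _ do rewrite ffunE mulr_suml.
rewrite exchange_big /= [RHS]exchange_big /=.
apply: eq_bigr => x _.
rewrite [RHS](reindex_inj (mulgI x)) /=; apply: eq_bigr => y _.
rewrite actMr ?mXV // -actMg ?mXV // mulrA mulKg.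
by congr (_ * _ * act (h _) _); rewrite invMg ?mulgA //.
Qed.

Let subg1 : subg M 1%g = 1%g. Proof. by rewrite morph1. Qed.

Let skew1M : left_id skew1 skewM.
Proof.
move=> f; apply/ffunP=> z; rewrite ffunE (bigD1 1%g) //= big1 ?addr0.
  by rewrite ffunE subg1 eqxx mul1r invg1 mul1g invg1 act1g.
by move=> x x1; rewrite ffunE subg1 (negPf x1) mul0r.
Qed.

Let skewM1 : right_id skew1 skewM.
Proof.
move=> f; apply/ffunP=> z; rewrite ffunE (bigD1 z) //= big1 ?addr0.
  by rewrite ffunE subg1 mulVg eqxx act_one ?mXV // mulr1.
move=> x xz; rewrite ffunE subg1 -eq_mulVg1 (negPf xz).
by rewrite act0 ?mXV // mulr0.
Qed.

Let skewMDl : left_distributive skewM +%R.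
Proof.
move=> f g h; apply/ffunP=> z; rewrite !ffunE -big_split /=.
by apply: eq_bigr => x _; rewrite ffunE mulrDl.
Qed.

Let skewMDr : right_distributive skewM +%R.
Proof.
move=> f g h; apply/ffunP=> z; rewrite !ffunE -big_split /=.
by apply: eq_bigr => x _; rewrite ffunE actD ?mXV // mulrDr.
Qed.

HB.instance Definition _ :=
  GRing.Zmodule_isPzRing.Build skew skewMA skew1M skewM1 skewMDl skewMDr.

Lemma skew_pureB a b x : skew_pure (a - b) x = skew_pure a x - skew_pure b x.
Proof. by apply/ffunP=> z; rewrite !ffunE; case: eqP; rewrite ?subr0. Qed.

Lemma skew_pureM a b x y : x \in M -> y \in M ->
  skew_pure a x * skew_pure b y = skew_pure (a * act b x^-1) (x * y).
Proof.
move=> xM yM; apply/ffunP=> z; rewrite ffunE (bigD1 (subg M x)) //= big1 ?addr0.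
  rewrite !ffunE eqxx subgK // morphM // -(inj_eq (mulgI (subg M x))) mulKVg.
  by case: eqP => // _; rewrite act0 ?mulr0 // groupV MX.
by move=> t tx; rewrite ffunE (negPf tx) mul0r.
Qed.

Lemma skew_act_pure a x h : x \in M -> h \in X ->
  skew_act (skew_pure a x) h = skew_pure (act a h) (x ^ h).
Proof.
move=> xM hX; have hN := fintype.subsetP (normal_norm nMX) _ hX.
apply/ffunP=> z; rewrite !ffunE.
have -> : (subg M (sgval z ^ h^-1) == subg M x) = (z == subg M (x ^ h)).
  apply/eqP/eqP => [E|->].
    have /(congr1 sgval) := E; rewrite !subgK ?memJ_norm ?groupV ?subgP // => <-.
    by rewrite conjgKV sgvalK.
  by rewrite subgK ?memJ_norm // conjgK.
by case: eqP => // _; rewrite act0.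
Qed.

Lemma skew_sum (f : skew) : f = \sum_(x : subg_of M) skew_pure (f x) (sgval x).
Proof.
apply/ffunP=> z; rewrite sum_ffunE (bigD1 z) //= big1 ?addr0.
  by rewrite ffunE sgvalK eqxx.
by move=> x xz; rewrite ffunE sgvalK eq_sym (negPf xz).
Qed.

Let skew_scalB : GRing.zmod_morphism skew_scal.
Proof. by move=> c d; rewrite /skew_scal rmorphB skew_pureB. Qed.
Let skew_scalM : GRing.monoid_morphism skew_scal.
Proof.
split=> [|c d]; rewrite /skew_scal ?rmorph1 //.
by rewrite rmorphM skew_pureM // invg1 act1g mulg1.
Qed.
HB.instance Definition _ := GRing.isZmodMorphism.Build O skew skew_scal skew_scalB.
HB.instance Definition _ := GRing.isMonoidMorphism.Build O skew skew_scal skew_scalM.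

Let skew_scalC c (f : skew) : skew_scal c * f = f * skew_scal c.
Proof.
rewrite [f]skew_sum mulr_suml mulr_sumr; apply: eq_bigr => x _.
have xM : sgval x \in M by exact: subgP.
by rewrite !skew_pureM // mul1g mulg1 invg1 act1g act_scal ?alg_scalC ?mXV.
Qed.

Definition skew_ring : unitaryAlg O := UnitaryAlg skew_scalC.

Let skew_actD (f g : skew) h : h \in X ->
  skew_act (f + g) h = skew_act f h + skew_act g h.
Proof. by move=> hX; apply/ffunP=> z; rewrite !ffunE actD. Qed.

Let skew_act_sum (I : Type) (r : seq I) (F : I -> skew) h : h \in X ->
  skew_act (\sum_(i <- r) F i) h = \sum_(i <- r) skew_act (F i) h.
Proof.
move=> hX; apply: (big_morph (fun a => skew_act a h)) => [a b|]; first exact: skew_actD.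
by apply/ffunP=> z; rewrite !ffunE act0.
Qed.

Let skew_actMr (f g : skew) h : h \in X ->
  skew_act (f * g) h = skew_act f h * skew_act g h.
Proof.
move=> hX; have hN := fintype.subsetP (normal_norm nMX) _ hX.
rewrite [f]skew_sum [g]skew_sum !(skew_act_sum, mulr_suml) //.
apply: eq_bigr => x _; rewrite !(skew_act_sum, mulr_sumr) //.
apply: eq_bigr => y _; have xM := subgP x; have yM := subgP y.
rewrite skew_pureM // !skew_act_pure ?groupM // skew_pureM ?memJ_norm //.
rewrite actMr // -conjMg; congr (skew_pure (_ * _) _).
have xX := MX xM.
by rewrite -!actMg ?groupV ?groupJ // -conjVg -conjgC.
Qed.

Let skew_act_scal c h : h \in X -> skew_act (skew_scal c) h = skew_scal c.
Proof. by move=> hX; rewrite skew_act_pure // act_scal // conj1g. Qed.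
Let skew_act_one h : h \in X -> skew_act 1 h = 1.
Proof. by move=> hX; rewrite [LHS]skew_act_pure // act_one // conj1g. Qed.
Let skew_act1g f : skew_act f 1%g = f.
Proof. by apply/ffunP=> z; rewrite ffunE act1g invg1 conjg1 sgvalK. Qed.
Let skew_actMg f h h' : h \in X -> h' \in X ->
  skew_act f (h * h')%g = skew_act (skew_act f h) h'.
Proof.
move=> hX hX'; have hN' := fintype.subsetP (normal_norm nMX) _ hX'.
apply/ffunP=> z; rewrite !ffunE actMg // subgK ?memJ_norm ?groupV ?subgP //.
by rewrite invMg conjgM.
Qed.

Definition skewAlg : actAlg O X :=
  @ActAlg O gT X skew_ring skew_act skew_actD skew_actMr skew_act_scal skew_act_one
    skew_act1g skew_actMg.

Hypothesis sLM : L \subset M.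
Let LM y : y \in L -> y \in M. Proof. exact: (fintype.subsetP sLM). Qed.

(* the relations a (y . 1) (x) x = a (x) yx, for y in L                       *)
Definition tensor_gen : set skewAlg :=
  [set f | exists a y x, [/\ y \in L, x \in M &
    f = skew_pure (a * ia_int y) x - skew_pure a (y * x)%g]]%classic.

Definition tensor_set (f : skewAlg) : Prop := span tensor_gen f.

Let tensor_sum (I : Type) (r : seq I) (F : I -> skewAlg) :
  (forall i, tensor_set (F i)) -> tensor_set (\sum_(i <- r) F i).
Proof.
move=> HF; apply: (big_ind tensor_set) => [||i _]; [exact: Span0| |exact: HF].
move=> f g Hf Hg; rewrite -[g]opprK -[- g]sub0r.
by do 2!apply: SpanB => //; exact: Span0.
Qed.

Let tsMl f g : tensor_set g -> tensor_set (f * g).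
Proof.
elim=> [_ [a [y [x [yL xM ->]]]]||u v _ Hu _ Hv].
- rewrite [f]skew_sum mulr_suml; apply: tensor_sum => z.
  have zM := subgP z; have zX := MX zM; have yM := LM yL.
  rewrite mulrBr !skew_pureM ?groupM //; apply: SpanIn.
  have yzL : (y ^ (sgval z)^-1)%g \in L.
    by rewrite memJ_norm // (fintype.subsetP (normal_norm (ia_normal B))) // groupV.
  exists (f z * act a (sgval z)^-1), (y ^ (sgval z)^-1)%g, (sgval z * x)%g.
  split; [exact: yzL|exact: groupM|].
  rewrite actMr ?groupV // ia_intJ ?groupV // mulrA; congr (_ - skew_pure _ _).
  by rewrite conjgE invgK !mulgA mulgKV.
- by rewrite mulr0; exact: Span0.
- by rewrite mulrBr; exact: SpanB.
Qed.

Let tsMr f g : tensor_set g -> tensor_set (g * f).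
Proof.
elim=> [_ [a [y [x [yL xM ->]]]]||u v _ Hu _ Hv].
- rewrite [f]skew_sum mulr_sumr; apply: tensor_sum => z.
  have zM := subgP z; have zX := MX zM; have yM := LM yL; have yX := MX yM.
  have xX := MX xM.
  rewrite mulrBl !skew_pureM ?groupM //; apply: SpanIn.
  exists (a * (ia_int y * act (f z) x^-1 * ia_int y^-1)), y, (x * sgval z)%g.
  split; [exact: yL|exact: groupM|].
  rewrite -!mulrA -ia_intM ?groupV // mulVg ia_int1 mulr1.
  congr (_ - skew_pure (_ * _) _); last by rewrite mulgA.
  by rewrite invMg actMg ?groupV // ia_actE ?groupV // invgK -mulrA.
- by rewrite mul0r; exact: Span0.
- by rewrite mulrBl; exact: SpanB.
Qed.

Let ts_act f h : h \in X -> tensor_set f -> tensor_set (act f h).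
Proof.
move=> hX; have hM := fintype.subsetP (normal_norm nMX) _ hX.
have hL := fintype.subsetP (normal_norm (ia_normal B)) _ hX.
elim=> [_ [a [y [x [yL xM ->]]]]||u v _ Hu _ Hv].
- have yxM : (y * x)%g \in M := groupM (LM yL) xM.
  have E b z : z \in M ->
      act (skew_pure b z : skewAlg) h = skew_pure (act b h) (z ^ h).
    by move=> zM; exact: skew_act_pure.
  rewrite actB // !E //; apply: SpanIn.
  exists (act a h), (y ^ h)%g, (x ^ h)%g; split; rewrite ?memJ_norm //.
  by rewrite actMr // ia_intJ // conjMg.
- by rewrite act0 //; exact: Span0.
- by rewrite actB //; exact: SpanB.
Qed.

Definition tensorIdeal : stable_ideal skewAlg :=
  @StableIdeal _ _ _ skewAlg tensor_set (@Span0 _ _) (@SpanB _ _) tsMl tsMr ts_act.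

Definition tensorAct := quotAlg tensorIdeal.

Definition tens (a : B) (x : gT) : tensorAct := quot_pi tensorIdeal (skew_pure a x).

Lemma tensM a b x y : x \in M -> y \in M ->
  tens a x * tens b y = tens (a * act b x^-1) (x * y).
Proof. by move=> xM yM; rewrite [LHS]quot_piM; congr quot_pi; exact: skew_pureM. Qed.

Lemma tensB a b x : tens (a - b) x = tens a x - tens b x.
Proof. by rewrite /tens skew_pureB; exact: (quot_piB tensorIdeal). Qed.

Lemma tens_act a x h : x \in M -> h \in X -> act (tens a x) h = tens (act a h) (x ^ h).
Proof. by move=> xM hX; rewrite [LHS]quot_pi_act // [act _ _]skew_act_pure. Qed.

Lemma tens1 : tens 1 1%g = 1. Proof. by []. Qed.

Lemma tens_scal c : tens (alg_scal B c) 1%g = alg_scal tensorAct c.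
Proof. by []. Qed.

Lemma tens_eq a y x : y \in L -> x \in M -> tens (a * ia_int y) x = tens a (y * x).
Proof.
by move=> yL xM; apply/quot_piE; apply: SpanIn; exists a, y, x.
Qed.

Lemma tens_sum (q : tensorAct) :
  exists f : subg_of M -> B, q = \sum_(x : subg_of M) tens (f x) (sgval x).
Proof.
elim/quot_ind: q => f; exists f; rewrite {1}[f]skew_sum.
apply: (big_morph (quot_pi tensorIdeal)) => //.
by move=> a b; rewrite [RHS]quot_piD.
Qed.

Let tint1 : tens 1 1%g = 1. Proof. by []. Qed.
Let tintM y z : y \in M -> z \in M -> tens 1 (y * z) = tens 1 y * tens 1 z.
Proof.
by move=> yM zM; rewrite tensM // act_one ?mul1r // groupV MX.
Qed.
Let tintJ y h : y \in M -> h \in X -> act (tens 1 y) h = tens 1 (y ^ h).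
Proof. by move=> yM hX; rewrite tens_act // act_one. Qed.
Let tactE y q : y \in M -> act q y = tens 1 y^-1 * q * tens 1 y.
Proof.
move=> yM; have yX := MX yM; have [f ->] := tens_sum q.
rewrite act_sum // mulr_sumr mulr_suml; apply: eq_bigr => x _.
have xM := subgP x; have xX := MX xM.
rewrite tens_act // !tensM ?groupM ?groupV // invgK mul1r.
by rewrite act_one ?mulr1 ?groupV ?groupM ?groupV // conjgE mulgA.
Qed.

(* B (x)_{OL} OM, as an M-interior X-algebra *)
Definition tensor : interiorAlg O M X :=
  @InteriorAlg O gT M X tensorAct (tens 1) nMX tint1 tintM tintJ tactE.

(* the component of degree sigma in M / L *)
Definition tensor_comp (sigma : coset_of L) : set tensor :=
  [set q | exists a x, [/\ x \in M, coset L x = sigma & q = tens a x]]%classic.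

End SkewAlgebra.
(* An algebra graded by a group of cosets of L, the action of X being         *)
(* compatible with conjugation of degrees.                                    *)
Record grading (O : pzRingType) (gT : finGroupType) (X : {group gT})
    (A : actAlg O X) (L : {group gT}) := Grading {
  gr_grp : {group coset_of L};
  gr_comp : coset_of L -> set A;
  gr_norm : X \subset 'N(L);
  gr0 : forall s, s \in gr_grp -> gr_comp s 0;
  grB : forall s x y, s \in gr_grp ->
    gr_comp s x -> gr_comp s y -> gr_comp s (x - y);
  grZ : forall s c x, s \in gr_grp -> gr_comp s x -> gr_comp s (alg_scal A c * x);
  gr1 : gr_comp 1%g 1;
  grM : forall s t x y, s \in gr_grp -> t \in gr_grp ->
    gr_comp s x -> gr_comp t y -> gr_comp (s * t)%g (x * y);
  gr_act : forall s x h, s \in gr_grp -> h \in X ->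
    gr_comp s x -> gr_comp (s ^ coset L h)%g (act x h)
}.

Section TensorGrading.
Variables (O : pzRingType) (gT : finGroupType) (L X : {group gT}).
Variables (B : interiorAlg O L X) (M : {group gT}) (nMX : M <| X) (sLM : L \subset M).

Let MX x : x \in M -> x \in X. Proof. exact: (fintype.subsetP (normal_sub nMX)). Qed.
Let nXL : X \subset 'N(L). Proof. exact: normal_norm (ia_normal B). Qed.
Let MN x : x \in M -> x \in 'N(L). Proof. by move/MX/(fintype.subsetP nXL). Qed.
Let comp := @tensor_comp _ _ _ _ B _ nMX sLM.

Let tg0 s : s \in (M / L)%g -> comp s 0.
Proof.
case/morphimP=> x xN xM ->; exists 0, x; split=> //.
by rewrite -(subrr (0 : B)) tensB subrr.
Qed.

Let tgB s x y : s \in (M / L)%g -> comp s x -> comp s y -> comp s (x - y).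
Proof.
move=> _ [a [m [mM <- ->]]] [b [n [nM Emn ->]]].
have nE : n \in (L :* m)%g by apply/rcoset_kercosetP => //; exact: MN.
case/rcosetP: nE => l lL ->; exists (a - b * ia_int l), m; split=> //.
by rewrite tensB tens_eq.
Qed.

Let tgZ s c x : s \in (M / L)%g -> comp s x -> comp s (alg_scal (tensor B nMX sLM) c * x).
Proof.
move=> _ [a [m [mM <- ->]]]; exists (alg_scal B c * a), m; split=> //.
by rewrite -tens_scal tensM // invg1 act1g mul1g.
Qed.

Let tg1 : comp 1%g 1.
Proof. by exists 1, 1%g; rewrite morph1. Qed.

Let tgM s t x y : s \in (M / L)%g -> t \in (M / L)%g ->
  comp s x -> comp t y -> comp (s * t)%g (x * y).
Proof.
move=> _ _ [a [m [mM <- ->]]] [b [n [nM <- ->]]].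
exists (a * act b m^-1), (m * n)%g; split; first exact: groupM.
  by rewrite morphM ?MN.
by rewrite tensM.
Qed.

Let tg_act s x h : s \in (M / L)%g -> h \in X ->
  comp s x -> comp (s ^ coset L h)%g (act x h).
Proof.
move=> _ hX [a [m [mM <- ->]]]; exists (act a h), (m ^ h)%g; split.
- by rewrite memJ_norm // (fintype.subsetP (normal_norm nMX)).
- by rewrite morphJ ?(MN mM) ?(fintype.subsetP nXL _ hX).
by rewrite tens_act.
Qed.

Definition tensorGrading : grading (tensor B nMX sLM) L :=
  @Grading O gT X (tensor B nMX sLM) L (M / L)%G comp nXL tg0 tgB tgZ tg1 tgM tg_act.

End TensorGrading.

Section BrauerGrading.
Variables (O k : pzRingType) (res : {rmorphism O -> k}).
Variables (gT : finGroupType) (M H L : {group gT}) (A : interiorAlg O M H).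
Variables (g : grading A L) (P : {group gT}) (sPH : P \subset H).

(* A(P)_s is the image of A_s^P under Br_P                                    *)
Definition brauer_comp (s : coset_of L) : set (brauer res A sPH) :=
  [set q | exists u, [/\ fixed P u, gr_comp g s u & q = Br res sPH u]]%classic.

Let S := fixedSubalg A sPH.
Let NH h : h \in 'N_H(P) -> h \in H. Proof. by case/setIP. Qed.

Let bg0 s : s \in gr_grp g -> brauer_comp s 0.
Proof.
move=> sg; exists 0; split; [|exact: gr0|].
  by move=> q /(fintype.subsetP sPH) qH; rewrite act0.
by rewrite -(subrr (1 : A)) BrB ?subrr //; exact: (sa1 S).
Qed.

Let bgB s x y : s \in gr_grp g -> brauer_comp s x -> brauer_comp s y ->
  brauer_comp s (x - y).
Proof.
move=> sg [u [Fu cu ->]] [v [Fv cv ->]]; exists (u - v); split.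
- exact: (saB (s := S)).
- exact: grB.
by rewrite BrB.
Qed.

Let bgZ s c x : s \in gr_grp g -> brauer_comp s x ->
  brauer_comp s (alg_scal (brauer res A sPH) c * x).
Proof.
move=> sg [u [Fu cu ->]]; exists (alg_scal A c * u); split.
- exact: (saZ (s := S)).
- exact: grZ.
have Fc : fixed P (alg_scal A c).
  by rewrite -[alg_scal A c]mulr1; apply: (saZ (s := S)); exact: (sa1 S).
by rewrite BrM // Br_scal.
Qed.

Let bg1 : brauer_comp 1%g 1.
Proof. by exists 1; split; [exact: (sa1 S)|exact: gr1|rewrite Br1]. Qed.

Let bgM s t x y : s \in gr_grp g -> t \in gr_grp g ->
  brauer_comp s x -> brauer_comp t y -> brauer_comp (s * t)%g (x * y).
Proof.
move=> sg tg [u [Fu cu ->]] [v [Fv cv ->]]; exists (u * v); split.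
- exact: (saM (s := S)).
- exact: grM.
by rewrite BrM.
Qed.

Let bg_act s x h : s \in gr_grp g -> h \in 'N_H(P) ->
  brauer_comp s x -> brauer_comp (s ^ coset L h)%g (act x h).
Proof.
move=> sg hN [u [Fu cu ->]]; exists (act u h); split.
- exact: (sa_act (s := S)).
- by apply: gr_act => //; exact: NH.
by rewrite [LHS]Br_act.
Qed.

Let bg_norm : 'N_H(P) \subset 'N(L).
Proof. exact: fintype.subset_trans (finset.subsetIl _ _) (gr_norm g). Qed.

Definition brauerGrading : grading (brauer res A sPH) L :=
  @Grading O gT 'N_H(P)%G (brauer res A sPH) L (gr_grp g) brauer_comp
    bg_norm bg0 bgB bgZ bg1 bgM bg_act.

End BrauerGrading.

(* Given a graded algebra A, a group F acting on it and an F-fixed idempotent *)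
(* e, this section builds, from the components C_s = e (A_s)^F with s in Gr,  *)
(* the support S = {s in Gr | C_s C_{s^-1} = C_1} (corner_support), the sum C *)
(* of the C_s with s in S, which is a ring with identity element e            *)
(* (crossedAlg), the ring C_1 (unitAlg1), its radical J(C_1) as a subset of A *)
(* (jac1), the quotient C / C J(C_1) (barAlg) and its group of homogeneous    *)
(* units (hunit), all of them with the action of N.                           *)
Section Corner.
Variables (O : pzRingType) (gT : finGroupType) (X : {group gT}) (A : actAlg O X).
Variables (L : {group gT}) (g : grading A L) (F : {group gT}) (e : A).

(* This is also (e A_s)^F, see cornerP below.                                 *)
Definition corner (s : coset_of L) : set A :=
  [set x | exists u, [/\ gr_comp g s u, fixed F u & x = e * u]]%classic.

Definition corner_support (Gr : {set coset_of L}) : {set coset_of L} :=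
  [set s in Gr | `[< mulspan (corner s) (corner s^-1%g) = corner 1%g >]].

Record corner_axioms (Gr : {group coset_of L}) (N : {group gT}) : Prop :=
    CornerAxioms {
  ca_F : F \subset X;
  ca_N : N \subset X;
  ca_NF : N \subset 'N(F);
  ca_Gr : Gr \subset gr_grp g;
  ca_ee : e * e = e;
  ca_Fe : fixed F e;
  ca_1e : gr_comp g 1%g e;
  ca_comm : forall s u, s \in Gr -> gr_comp g s u -> e * u = u * e;
  ca_Ne : fixed N e;
  ca_NGr : forall h, h \in N -> coset L h \in 'N(Gr)%g
}.

Variables (Gr : {group coset_of L}) (N : {group gT}) (ax : corner_axioms Gr N).

Local Notation X_ := corner.
Local Notation Gam := (corner_support Gr).

Let inX x : x \in F -> x \in X. Proof. exact: (fintype.subsetP (ca_F ax)). Qed.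
Let inXN x : x \in N -> x \in X. Proof. exact: (fintype.subsetP (ca_N ax)). Qed.
Let inG s : s \in Gr -> s \in gr_grp g. Proof. exact: (fintype.subsetP (ca_Gr ax)). Qed.
Let e_idem := ca_ee ax.

Let fixF0 : fixed F (0 : A). Proof. by move=> q /inX qX; rewrite act0. Qed.
Let fixFB (x y : A) : fixed F x -> fixed F y -> fixed F (x - y).
Proof. by move=> Fx Fy q qF; rewrite actB ?inX // Fx // Fy. Qed.
Let fixFM (x y : A) : fixed F x -> fixed F y -> fixed F (x * y).
Proof. by move=> Fx Fy q qF; rewrite actMr ?inX // Fx // Fy. Qed.
Lemma cornerP s x : s \in Gr ->
  corner s x <-> (exists2 u, gr_comp g s u & x = e * u) /\ fixed F x.
Proof.
move=> sG; split=> [[u [cu Fu ->]]|[[u cu ->] Fx]].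
  by split; [exists u|apply: fixFM => //; exact: ca_Fe ax].
exists (e * u); split=> //; last by rewrite mulrA e_idem.
by rewrite -[s]mul1g; apply: grM => //; [exact: inG|exact: ca_1e ax].
Qed.

Let fixFZ c (x : A) : fixed F x -> fixed F (alg_scal A c * x).
Proof. by move=> Fx q qF; rewrite actMr ?inX // act_scal ?inX // Fx. Qed.

Let X0 s : s \in Gr -> X_ s 0.
Proof. by move/inG=> sG; exists 0; split; [exact: gr0|exact: fixF0|rewrite mulr0]. Qed.

Let XB s x y : s \in Gr -> X_ s x -> X_ s y -> X_ s (x - y).
Proof.
move/inG=> sG [u [cu Fu ->]] [v [cv Fv ->]]; exists (u - v).
by split; [exact: grB|exact: fixFB|rewrite mulrBr].
Qed.

Let XZ s c x : s \in Gr -> X_ s x -> X_ s (alg_scal A c * x).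
Proof.
move/inG=> sG [u [cu Fu ->]]; exists (alg_scal A c * u).
by split; [exact: grZ|exact: fixFZ|rewrite mulrA alg_scalC -mulrA].
Qed.

Let Xe : X_ 1%g e.
Proof. by exists e; split; [exact: ca_1e ax|exact: ca_Fe ax|]. Qed.

Let XM s t x y : s \in Gr -> t \in Gr -> X_ s x -> X_ t y -> X_ (s * t)%g (x * y).
Proof.
move=> sG tG [u [cu Fu ->]] [v [cv Fv ->]]; exists (u * v).
split; [by apply: grM => //; apply: inG|exact: fixFM|].
by rewrite -mulrA (mulrA u) -(ca_comm ax sG cu) !mulrA e_idem.
Qed.

Let eX s x : X_ s x -> e * x = x.
Proof. by case=> u [_ _ ->]; rewrite mulrA e_idem. Qed.

Let Xeq s x : s \in Gr -> X_ s x -> x * e = x.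
Proof. by move=> sG [u [cu _ ->]]; rewrite -mulrA -(ca_comm ax sG cu) mulrA e_idem. Qed.

Let X_act s x h : s \in Gr -> h \in N -> X_ s x -> X_ (s ^ coset L h)%g (act x h).
Proof.
move=> sG hN [u [cu Fu ->]]; exists (act u h); split.
- by apply: gr_act; [exact: inG|exact: inXN|].
- move=> q qF; have hF := fintype.subsetP (ca_NF ax) _ hN.
  have qF' : (q ^ h^-1)%g \in F by rewrite memJ_norm // groupV.
  rewrite -(actMg _ (inXN hN) (inX qF)) conjgCV.
  by rewrite (actMg _ (inX qF') (inXN hN)) Fu.
- by rewrite actMr ?inXN // (ca_Ne ax hN).
Qed.

Let GJ s h : s \in Gr -> h \in N -> (s ^ coset L h)%g \in Gr.
Proof. by move=> sG hN; rewrite memJ_norm // (ca_NGr ax). Qed.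

Let mulX_sub s t z : s \in Gr -> t \in Gr ->
  mulspan (X_ s) (X_ t) z -> X_ (s * t)%g z.
Proof.
move=> sG tG; elim=> [_ [x [y [Xx Xy ->]]]||x y _ Hx _ Hy].
- exact: XM.
- by apply: X0; rewrite groupM.
- by apply: XB => //; rewrite groupM.
Qed.

Lemma corner_supportP s :
  reflect (s \in Gr /\ mulspan (X_ s) (X_ s^-1%g) e) (s \in Gam).
Proof.
rewrite inE; apply: (iffP andP) => -[sG].
  by move/asboolP=> E; split=> //; rewrite E; exact: Xe.
move=> He; split=> //; apply/asboolP/seteqP; split=> z.
  by move/mulX_sub; rewrite mulgV; apply=> //; rewrite groupV.
move=> Xz; rewrite -(eX Xz); elim: He => [_ [x [y [Xx Xy ->]]]||x y _ Hx _ Hy].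
- apply: SpanIn; exists x, (y * z); rewrite mulrA; split=> //.
  by rewrite -[(s^-1)%g]mulg1; apply: XM; rewrite ?groupV.
- by rewrite mul0r; exact: Span0.
- by rewrite mulrBl; exact: SpanB.
Qed.

Lemma corner_support_group_set : group_set Gam.
Proof.
apply/group_setP; split.
  apply/corner_supportP; split; first exact: group1.
  rewrite invg1; apply: SpanIn; exists e, e; split; rewrite ?e_idem //; exact: Xe.
move=> s t /corner_supportP[sG Hs] /corner_supportP[tG Ht].
apply/corner_supportP; split; first exact: groupM.
elim: Hs => [_ [x [y [Xx Xy ->]]]||x y _ Hx _ Hy]; [|exact: Span0|exact: SpanB].
rewrite -(eX Xy) mulrA; elim: Ht => [_ [z [w [Xz Xw ->]]]||z w _ Hz _ Hw].
- apply: SpanIn; exists (x * z), (w * y); split; first exact: XM.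
    by rewrite invMg; apply: XM; rewrite ?groupV.
  by rewrite !mulrA.
- by rewrite mulr0 mul0r; exact: Span0.
- by rewrite mulrBr mulrBl; exact: SpanB.
Qed.

Canonical corner_support_group := Group corner_support_group_set.

Let GamG s : s \in Gam -> s \in Gr. Proof. by case/corner_supportP. Qed.

Let GamJ s h : s \in Gam -> h \in N -> (s ^ coset L h)%g \in Gam.
Proof.
case/corner_supportP=> sG Hs hN; apply/corner_supportP; split; first exact: GJ.
rewrite -(ca_Ne ax hN); have hX := inXN hN.
elim: Hs => [_ [x [y [Xx Xy ->]]]||x y _ Hx _ Hy].
- rewrite actMr //; apply: SpanIn; exists (act x h), (act y h); split=> //.
    exact: X_act.
  by rewrite -conjVg; apply: X_act; rewrite ?groupV.
- by rewrite act0 //; exact: Span0.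
- by rewrite actB //; exact: SpanB.
Qed.

Definition crossed_set : set A :=
  span [set x | exists2 s, s \in Gam & X_ s x]%classic.

Let crX s x : s \in Gam -> X_ s x -> crossed_set x.
Proof. by move=> sG Xx; apply: SpanIn; exists s. Qed.

Let crM x y : crossed_set x -> crossed_set y -> crossed_set (x * y).
Proof.
move=> Hx Hy; elim: Hx => [{}x [s sG Xx]||u v _ Hu _ Hv].
- elim: Hy => [{}y [t tG Xy]||u v _ Hu _ Hv].
  + by apply: (@crX (s * t)%g); [exact: groupM|apply: XM => //; apply: GamG].
  + by rewrite mulr0; exact: Span0.
  + by rewrite mulrBr; exact: SpanB.
- by rewrite mul0r; exact: Span0.
- by rewrite mulrBl; exact: SpanB.
Qed.

Let crZ c x : crossed_set x -> crossed_set (alg_scal A c * x).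
Proof.
elim=> [{}x [s sG Xx]||u v _ Hu _ Hv].
- by apply: (crX sG); apply: XZ => //; exact: GamG.
- by rewrite mulr0; exact: Span0.
- by rewrite mulrBr; exact: SpanB.
Qed.

Let cr1 : crossed_set e. Proof. by apply: (@crX 1%g); [exact: group1|exact: Xe]. Qed.

Let cr1M x : crossed_set x -> e * x = x.
Proof.
elim=> [{}x [s sG Xx]||u v _ Hu _ Hv]; [exact: eX Xx|by rewrite mulr0|].
by rewrite mulrBr Hu Hv.
Qed.

Let crM1 x : crossed_set x -> x * e = x.
Proof.
elim=> [{}x [s sG Xx]||u v _ Hu _ Hv]; [|by rewrite mul0r|by rewrite mulrBl Hu Hv].
by apply: Xeq Xx; exact: GamG.
Qed.

Let cr_act x h : h \in N -> crossed_set x -> crossed_set (act x h).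
Proof.
move=> hN; have hX := inXN hN; elim=> [{}x [s sG Xx]||u v _ Hu _ Hv].
- by apply: (@crX (s ^ coset L h)%g); [exact: GamJ|apply: X_act => //; exact: GamG].
- by rewrite act0 //; exact: Span0.
- by rewrite actB //; exact: SpanB.
Qed.

Definition crossedSubalg : stable_subalg A N :=
  @StableSubalg _ _ _ A N crossed_set e (ca_N ax) (@SpanB _ _) crM crZ cr1 cr1M crM1
    cr_act (ca_Ne ax).

Definition crossedAlg := subAlg crossedSubalg.

Let one_Gr : (1%g : coset_of L) \in Gr. Proof. exact: group1. Qed.

Let x1M x y : X_ 1%g x -> X_ 1%g y -> X_ 1%g (x * y).
Proof. by move=> Xx Xy; rewrite -[1%g]mulg1; apply: XM. Qed.
Let x1_act x h : h \in N -> X_ 1%g x -> X_ 1%g (act x h).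
Proof. by move=> hN Xx; rewrite -(conj1g (coset L h)); apply: X_act. Qed.

Definition unitSubalg : stable_subalg A N :=
  @StableSubalg _ _ _ A N (X_ 1%g) e (ca_N ax) (fun x y => XB one_Gr) x1M
    (fun c x => XZ c one_Gr) Xe (fun x => @eX 1%g x) (fun x => Xeq one_Gr)
    x1_act (ca_Ne ax).

Definition unitAlg1 := subAlg unitSubalg.

Definition jac1 : set A := [set x | exists2 j : unitAlg1, jacobson j & x = val j]%classic.

Let jac1P x : jac1 x <->
  X_ 1%g x /\ forall a, X_ 1%g a -> exists2 u, X_ 1%g u & u * (e - a * x) = e.
Proof.
split=> [[j /jacobsonP Jj ->]|[Xx Hx]].
  split; first exact: (sub_valP (S := unitSubalg) j).
  move=> a Xa; have [u /(congr1 val) E] := Jj (sub_in (S := unitSubalg) Xa).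
  by exists (val u) => //; exact: (sub_valP (S := unitSubalg) u).
exists (sub_in (S := unitSubalg) Xx) => //; apply/jacobsonP => a.
have [u Xu E] := Hx _ (sub_valP (S := unitSubalg) a).
by exists (sub_in (S := unitSubalg) Xu); apply: val_inj.
Qed.

Let jac1_conj s y j x : s \in Gam -> X_ s^-1%g y -> jac1 j -> X_ s x ->
  jac1 (y * j * x).
Proof.
move=> sG Xy /jac1P[Xj Hj] Xx; have sGr := GamG sG.
have sVGr : (s^-1)%g \in Gr by rewrite groupV.
have Xyj : X_ s^-1%g (y * j) by rewrite -[(s^-1)%g]mulg1; apply: XM.
apply/jac1P; split; first by rewrite -(mulVg s); apply: XM.
move=> a Xa.
have Xay : X_ s^-1%g (a * y) by rewrite -[(s^-1)%g]mul1g; apply: XM.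
have Xxay : X_ 1%g (x * (a * y)) by rewrite -(mulgV s); apply: XM.
have [u Xu E] := Hj _ Xxay.
pose t := a * y * j.
have Xt : X_ s^-1%g t by rewrite -[(s^-1)%g]mulg1; apply: XM.
have XuX : X_ s (u * x) by rewrite -[s]mul1g; apply: XM.
exists (e - (0 - t * u * x)).
  apply: XB => //; apply: XB => //; first exact: X0.
  by rewrite -(mulVg s) -mulrA; apply: XM.
have Xtx : X_ 1%g (t * x) by rewrite -(mulVg s); apply: XM.
have xe : x * e = x by apply: Xeq Xx.
have te : t * e = t by apply: Xeq Xt.
have -> : a * (y * j * x) = t * x by rewrite /t !mulrA.
have E' : u * (e - x * t) = e by rewrite -[RHS]E /t !mulrA.
have -> : (e - (0 - t * u * x)) * (e - t * x) = e - t * x + t * (u * (e - x * t)) * x.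
  rewrite sub0r opprK mulrDl mulrBr e_idem (eX Xtx); congr (_ + _).
  rewrite mulrBr -[t * u * x * e]mulrA xe (mulrBr u) (Xeq one_Gr Xu).
  by rewrite mulrBr mulrBl !mulrA.
by rewrite E' te subrK.
Qed.

Let jac1_act j h : h \in N -> jac1 j -> jac1 (act j h).
Proof.
move=> hN /jac1P[Xj Hj]; have hX := inXN hN.
apply/jac1P; split; first exact: x1_act.
move=> a Xa; have hVN : (h^-1)%g \in N by rewrite groupV.
have [u Xu E] := Hj _ (x1_act hVN Xa).
exists (act u h); first exact: x1_act.
have := congr1 (fun x => act x h) E.
by rewrite actMr // actB // actMr // actKV // (ca_Ne ax hN).
Qed.

Definition jac_set (u : crossedAlg) : Prop := mulspan crossed_set jac1 (val u).

Let jsMl u v : jac_set v -> jac_set (u * v).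
Proof.
have Cu := sub_valP (S := crossedSubalg) u.
rewrite /jac_set /=; elim=> [_ [c [j [Cc Jj ->]]]||x y _ Hx _ Hy].
- by apply: SpanIn; exists (val u * c), j; split=> //; [exact: crM|rewrite mulrA].
- by rewrite mulr0; exact: Span0.
- by rewrite mulrBr; exact: SpanB.
Qed.

Let jsMr u v : jac_set v -> jac_set (v * u).
Proof.
have Cu := sub_valP (S := crossedSubalg) u.
rewrite /jac_set /=; elim=> [_ [c [j [Cc Jj ->]]]||x y _ Hx _ Hy].
- elim: Cu => [x [s sG Xx]||x y _ Hx _ Hy].
  + have [sGr He] := elimT (corner_supportP s) sG.
    have [Xj _] := iffLR (jac1P j) Jj.
    rewrite -[j](eX Xj).
    elim: He => [_ [a [b [Xa Xb ->]]]||a b _ Ha _ Hb].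
    * apply: SpanIn; exists (c * a), (b * j * x); split; last by rewrite !mulrA.
        by apply: crM => //; exact: crX Xa.
      exact: jac1_conj Xx.
    * by rewrite mul0r mulr0 mul0r; exact: Span0.
    * by rewrite mulrBl mulrBr mulrBl; exact: SpanB.
  + by rewrite mulr0; exact: Span0.
  + by rewrite mulrBr; exact: SpanB.
- by rewrite mul0r; exact: Span0.
- by rewrite mulrBl; exact: SpanB.
Qed.

Let js_act u h : h \in N -> jac_set u -> jac_set (act u h).
Proof.
move=> hN; rewrite /jac_set val_sub_act //; have hX := inXN hN.
elim=> [_ [c [j [Cc Jj ->]]]||x y _ Hx _ Hy].
- rewrite actMr //; apply: SpanIn; exists (act c h), (act j h).
  by split=> //; [exact: cr_act|exact: jac1_act].
- by rewrite act0 //; exact: Span0.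
- by rewrite actB //; exact: SpanB.
Qed.

Definition jacIdeal : stable_ideal crossedAlg :=
  @StableIdeal _ _ _ crossedAlg jac_set (@Span0 _ _) (fun x y => @SpanB _ _ _ _)
    jsMl jsMr js_act.

Definition barAlg := quotAlg jacIdeal.

Definition bar_comp (s : coset_of L) : set barAlg :=
  [set q | exists u : crossedAlg, X_ s (val u) /\ q = quot_pi jacIdeal u]%classic.

Let bar_comp1 : bar_comp 1%g 1.
Proof. by exists 1; split=> //; exact: Xe. Qed.

Let bar_compM s t q r : s \in Gam -> t \in Gam -> bar_comp s q -> bar_comp t r ->
  bar_comp (s * t)%g (q * r).
Proof.
move=> sG tG [u [Xu ->]] [v [Xv ->]]; exists (u * v); split; last exact: quot_piM.
by apply: XM => //; exact: GamG.
Qed.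

Let bar_comp_act s q h : s \in Gam -> h \in N -> bar_comp s q ->
  bar_comp (s ^ coset L h)%g (act q h).
Proof.
move=> sG hN [u [Xu ->]]; exists (act u h); split; last by rewrite [LHS]quot_pi_act.
by rewrite val_sub_act //; apply: X_act => //; exact: GamG.
Qed.

(* A homogeneous unit is recorded together with its degree, which it          *)
(* determines; the inverse of a homogeneous unit of degree s is homogeneous   *)
(* of degree s^-1.                                                            *)
Definition is_hunit (x : barAlg * coset_of L) : Prop :=
  [/\ x.2 \in Gam, bar_comp x.2 x.1
    & exists v, [/\ bar_comp x.2^-1%g v, x.1 * v = 1 & v * x.1 = 1]].

Definition hunit := {x : barAlg * coset_of L | `[< is_hunit x >]}.
HB.instance Definition _ := Choice.on hunit.

Definition hu_val (u : hunit) : barAlg := (val u).1.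
Definition hu_deg (u : hunit) : coset_of L := (val u).2.

Definition hunit_in x (hx : is_hunit x) : hunit := exist _ x (asboolT hx).

Lemma hunitP (u : hunit) : is_hunit (val u). Proof. exact/asboolP/(valP u). Qed.

Let hu_inv_ex (u : hunit) :
  exists v, [/\ bar_comp (hu_deg u)^-1%g v, hu_val u * v = 1 & v * hu_val u = 1].
Proof. by case: (hunitP u). Qed.

Let hinv (u : hunit) := projT1 (cid (hu_inv_ex u)).
Let hinvP u : [/\ bar_comp (hu_deg u)^-1%g (hinv u), hu_val u * hinv u = 1
  & hinv u * hu_val u = 1].
Proof. exact: projT2 (cid (hu_inv_ex u)). Qed.

Let hunit1 : is_hunit (1, 1%g).
Proof.
split=> /=; [exact: group1|exact: bar_comp1|].
by exists 1; rewrite invg1 mulr1; split=> //; exact: bar_comp1.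
Qed.

Let hunitM (u v : hunit) : is_hunit (hu_val u * hu_val v, (hu_deg u * hu_deg v)%g).
Proof.
have [uG Cu _] := hunitP u; have [vG Cv _] := hunitP v.
have [Ciu uV Vu] := hinvP u; have [Civ vV Vv] := hinvP v.
split=> /=; [exact: groupM|exact: bar_compM|exists (hinv v * hinv u); split].
- by rewrite invMg; apply: bar_compM; rewrite ?groupV.
- by rewrite mulrA -(mulrA (hu_val u)) vV mulr1.
- by rewrite mulrA -(mulrA (hinv v)) Vu mulr1.
Qed.

Let hunitV (u : hunit) : is_hunit (hinv u, (hu_deg u)^-1%g).
Proof.
have [uG Cu _] := hunitP u; have [Ciu uV Vu] := hinvP u.
by split=> /=; rewrite ?groupV //; exists (hu_val u); rewrite invgK; split.
Qed.

Definition hu1 : hunit := hunit_in hunit1.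
Definition huM (u v : hunit) : hunit := hunit_in (hunitM u v).
Definition huV (u : hunit) : hunit := hunit_in (hunitV u).

Let huMA : associative huM.
Proof. by move=> u v w; apply: val_inj; congr (_, _); rewrite /= ?mulrA ?mulgA. Qed.
Let hu1M : left_id hu1 huM.
Proof. by move=> u; apply: val_inj; case: u => -[x s] hx; congr (_, _); [exact: mul1r|exact: mul1g]. Qed.
Let huM1 : right_id hu1 huM.
Proof. by move=> u; apply: val_inj; case: u => -[x s] hx; congr (_, _); [exact: mulr1|exact: mulg1]. Qed.
Let huVM : left_inverse hu1 huV huM.
Proof.
by move=> u; apply: val_inj; have [_ _ E] := hinvP u; congr (_, _); [exact: E|exact: mulVg].
Qed.
Let huMV : right_inverse hu1 huV huM.
Proof.
by move=> u; apply: val_inj; have [_ E _] := hinvP u; congr (_, _); [exact: E|exact: mulgV].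
Qed.

HB.instance Definition _ := isGroup.Build hunit huMA hu1M huM1 huVM huMV.

Lemma hunit_act (u : hunit) h : h \in N ->
  is_hunit (act (hu_val u) h, (hu_deg u ^ coset L h)%g).
Proof.
move=> hN; have [uG Cu _] := hunitP u; have [Ciu uV Vu] := hinvP u.
split=> /=; [exact: GamJ|exact: bar_comp_act|exists (act (hinv u) h); split].
- by rewrite -conjVg; apply: bar_comp_act; rewrite ?groupV.
- apply: etrans (esym (@actMr _ _ _ barAlg _ _ h hN)) _.
  by rewrite [X in act X _]uV; exact: (@act_one _ _ _ barAlg h hN).
- apply: etrans (esym (@actMr _ _ _ barAlg _ _ h hN)) _.
  by rewrite [X in act X _]Vu; exact: (@act_one _ _ _ barAlg h hN).
Qed.

Definition hu_act (u : hunit) (h : gT) : hunit :=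
  insubd u (act (hu_val u) h, (hu_deg u ^ coset L h)%g).

Lemma val_hu_act u h : h \in N ->
  val (hu_act u h) = (act (hu_val u) h, (hu_deg u ^ coset L h)%g).
Proof. by move=> hN; rewrite insubdK //; apply/asboolP; exact: hunit_act. Qed.

End Corner.
(* The data E -> Q of a group extension 1 -> N -> E -> Q -> 1 together with an *)
(* action on E of a subgroup of gT. The group N is the kernel of ext_pr, so   *)
(* that a morphism which is compatible with the projections maps N to N'.     *)
Record extension (gT : finGroupType) := Extension {
  ext_grp :> groupType;
  ext_deg : finGroupType;
  ext_quo : {set ext_deg};
  ext_pr : ext_grp -> ext_deg;
  ext_prM : forall u v, ext_pr (u * v)%g = (ext_pr u * ext_pr v)%g;
  ext_pr_quo : forall u, ext_pr u \in ext_quo;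
  ext_act : ext_grp -> gT -> ext_grp
}.

Section ExtensionMorphisms.
Variables (gT : finGroupType) (E E' : extension gT).

Definition ext_morphism (f : E -> E') (c : ext_deg E -> ext_deg E') : Prop :=
  [/\ forall u v : E, f (u * v)%g = (f u * f v)%g,
      {in ext_quo E &, {morph c : s t / (s * t)%g}},
      forall s, s \in ext_quo E -> c s \in ext_quo E'
    & forall u, ext_pr (f u) = c (ext_pr u)].

Definition ext_isomorphism f c : Prop :=
  [/\ ext_morphism f c, bijective f, {in ext_quo E &, injective c}
    & c @: ext_quo E = ext_quo E'].

Definition ext_monomorphism f c : Prop :=
  [/\ ext_morphism f c, injective f & {in ext_quo E &, injective c}].

Definition ext_equivariant (N : {set gT}) (f : E -> E') : Prop :=
  forall h u, h \in N -> f (ext_act u h) = ext_act (f u) h.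

End ExtensionMorphisms.

Section UnitExtension.
Variables (O : pzRingType) (gT : finGroupType) (X : {group gT}) (A : actAlg O X).
Variables (L : {group gT}) (g : grading A L) (F : {group gT}) (e : A).
Variables (Gr : {group coset_of L}) (N : {group gT}) (ax : corner_axioms g F e Gr N).

Let hu_degM (u v : hunit ax) : hu_deg (u * v)%g = (hu_deg u * hu_deg v)%g.
Proof. by []. Qed.
Let hu_deg_supp (u : hunit ax) : hu_deg u \in corner_support g F e Gr.
Proof. by case: (hunitP u). Qed.

(* The kernel consists of the units of the degree 1 component C_1 / J(C_1) of  *)
(* C / C J(C_1).                                                              *)
Definition hU_extension : extension gT :=
  @Extension gT (hunit ax) (coset_of L) (corner_support g F e Gr)
    (@hu_deg _ _ _ _ _ _ _ _ _ _ ax) hu_degM hu_deg_supp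
    (@hu_act _ _ _ _ _ _ _ _ _ _ ax).

End UnitExtension.

Canonical stab_group (O : pzRingType) (gT : finGroupType) (X : {group gT})
    (A : actAlg O X) (N : {group gT}) (sNX : N \subset X) (a : A) :=
  Group (stab_group_set a sNX).

Section TensorCorner.
Variables (O : pzRingType) (gT : finGroupType) (L X : {group gT}).
Variables (B : interiorAlg O L X) (M : {group gT}) (nMX : M <| X) (sLM : L \subset M).
Variables (F N : {group gT}) (e : B).
Hypotheses (sFX : F \subset X) (sNX : N \subset X) (nNF : N \subset 'N(F)).
Hypotheses (ee : e * e = e) (eZ : forall a, e * a = a * e).
Hypotheses (Fe : fixed F e) (Ne : fixed N e) (Le : fixed L e).

Let sMX := normal_sub nMX.
Let MX x : x \in M -> x \in X. Proof. exact: (fintype.subsetP sMX). Qed.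
Let Me := stab_group sMX e.
Let nXL : X \subset 'N(L). Proof. exact: normal_norm (ia_normal B). Qed.

Lemma stab_comm (s : coset_of L) u : s \in (Me / L)%g ->
  tensor_comp (nMX := nMX) (sLM := sLM) s u ->
  tens nMX sLM e 1 * u = u * tens nMX sLM e 1.
Proof.
move=> sG [a [x [xM Ex ->]]].
have [h hN hMe Eh] := morphimP sG.
have xX := MX xM; have xN := fintype.subsetP nXL _ xX.
have xE : act e x = e.
  have : x \in (L :* h)%g by apply/rcoset_kercosetP => //; rewrite Ex Eh.
  case/rcosetP=> l lL ->; move: hMe; rewrite inE => /andP[hM /eqP hE].
  by rewrite (actMg _ (MX (fintype.subsetP sLM _ lL)) (MX hM)) Le.
rewrite !tensM // mulg1 mul1g invg1 act1g.
by rewrite -{2}xE actK // eZ.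
Qed.

Lemma tensor_corner_axioms :
  corner_axioms (tensorGrading B nMX sLM) F (tens nMX sLM e 1) (Me / L)%G N.
Proof.
have act_e h : h \in X -> act e h = e ->
    act (tens nMX sLM e 1 : tensor B nMX sLM) h = tens nMX sLM e 1.
  by move=> hX eh; rewrite [LHS]tens_act // eh conj1g.
split=> //.
- by apply: morphimS; apply/fintype.subsetP=> x; rewrite inE => /andP[].
- by rewrite tensM // invg1 act1g ee mulg1.
- by move=> q qF; apply: act_e; [exact: (fintype.subsetP sFX)|exact: Fe].
- by exists e, 1%g; rewrite morph1.
- by move=> s u sG cu; exact: stab_comm cu.
- by move=> h hN; apply: act_e; [exact: (fintype.subsetP sNX)|exact: Ne].
move=> h hN; have hX := fintype.subsetP sNX _ hN.
have hL := fintype.subsetP nXL _ hX.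
have hNM : h \in 'N(M) by exact: (fintype.subsetP (normal_norm nMX)).
apply: (fintype.subsetP (quotient_norm L Me)); apply: mem_quotient.
rewrite inE; apply/fintype.subsetP=> _ /imsetP[x xMe ->].
move: xMe; rewrite !inE => /andP[xM /eqP xE]; rewrite memJ_norm // xM /=.
have xX := MX xM.
rewrite conjgE !actMg ?groupM ?groupV // -{1}(Ne hN) actK // xE.
by rewrite (Ne hN) eqxx.
Qed.

End TensorCorner.

Section Setting.
Variables (O : pzRingType) (gT : finGroupType) (K H : {group gT}).
Variable A1 : interiorAlg O K H.

Definition primitive_idempotent (S : set A1) (b : A1) : Prop :=
  [/\ S b, b * b = b, b <> 0
    & forall e f, S e -> S f -> e * e = e -> f * f = f -> e * f = 0 -> f * e = 0 ->
      b = e + f -> e = 0 \/ f = 0].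

Definition block_idempotent (b : A1) : Prop :=
  primitive_idempotent (fixed K) b /\ forall a, b * a = a * b.

(* Dictionary, for A_1 : interiorAlg O K H, b : A_1 and P <= K:               *)
(*   extAlg A1    A = A_1 (x)_{OK} OH       to_ext b    b in A                *)
(*   stabH b      H_b                       stabG b     G_b = H_b / K         *)
(*   A1P          A_1(P)                    bbar        Br_P(b) in A_1(P)     *)
(*   AP           A(P)                      bbarA       Br_P(b) in A(P)       *)
(*   RP           R                         bbarR       Br_P(b) in R          *)
(*   NHb          N_H(P)_b                  NHbbar      N_H(P)_bbar           *)
(*   CHbbar       C_H(P)_bbar                                                 *)
(*   supp_b       G[b]                      supp_bbar   G[bbar]               *)
(*   supp_NH      \overline{N_H(P)}[bbar]   supp_CH     \overline{C_H(P)}[bbar]*)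
(*   ext1, ext2, ext3  the extensions given by hU of the quotients of C, D, E *)
(*   C1           C_1 = b A_1^K                                               *)
Definition extAlg : interiorAlg O H H :=
  tensor A1 (normal_refl H) (normal_sub (ia_normal A1)).

Definition extGrading : grading extAlg K :=
  tensorGrading A1 (normal_refl H) (normal_sub (ia_normal A1)).

Definition to_ext (a : A1) : extAlg :=
  tens (normal_refl H) (normal_sub (ia_normal A1)) a 1.

Definition stabH (b : A1) : {group gT} := stab_group (normal_sub (normal_refl H)) b.
Definition stabG (b : A1) : {group coset_of K} := (stabH b / K)%G.

Definition supp_b (b : A1) : {set coset_of K} :=
  corner_support extGrading K (to_ext b) (stabG b).

Section Defect.
Variables (k : pzRingType) (res : {rmorphism O -> k}) (b : A1).
Variables (P : {group gT}) (sPK : P \subset K).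

Definition subKH : P \subset H := fintype.subset_trans sPK (normal_sub (ia_normal A1)).

Definition A1P : interiorAlg O 'C_K(P) 'N_H(P) := brauer res A1 subKH.
Definition AP : interiorAlg O 'C_H(P) 'N_H(P) := brauer res extAlg subKH.
Definition APgrading : grading AP K := brauerGrading res extGrading subKH.

Definition bbar : A1P := Br res subKH b.
Definition bbarA : AP := Br res subKH (to_ext b).

Definition defect_group : Prop := trimg P K b /\ bbar <> 0.

Lemma cent_normal_norm : 'C_H(P) <| 'N_H(P).
Proof. exact: ia_normal AP. Qed.

Lemma centS : 'C_K(P) \subset 'C_H(P).
Proof. exact: finset.setSI (normal_sub (ia_normal A1)). Qed.

Definition RP : interiorAlg O 'C_H(P) 'N_H(P) := tensor A1P cent_normal_norm centS.
Definition RPgrading : grading RP 'C_K(P) := tensorGrading A1P cent_normal_norm centS.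
Definition bbarR : RP := tens cent_normal_norm centS bbar 1.

Definition NHb : {group gT} := @stab_group _ _ _ A1 'N_H(P)%G (finset.subsetIl _ _) b.
Definition NHbbar : {group gT} := @stab_group _ _ _ A1P 'N_H(P)%G (subxx _) bbar.
Definition CHbbar : {group gT} :=
  @stab_group _ _ _ A1P 'C_H(P)%G (normal_sub cent_normal_norm) bbar.

Definition supp_bbar : {set coset_of K} :=
  corner_support APgrading 'N_K(P)%G bbarA (stabG b).
Definition supp_NH : {set coset_of K} :=
  corner_support APgrading 'N_K(P)%G bbarA (NHb * K / K)%g.
Definition supp_CH : {set coset_of 'C_K(P)} :=
  corner_support RPgrading 'N_K(P)%G bbarR (CHbbar / 'C_K(P))%g.

(* C_H(P) / C_K(P) ~ C_H(P)K / K <= H / K; independent of the representative *)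
Definition natural_mono (t : coset_of 'C_K(P)) : coset_of K := coset K (repr t).

Hypothesis bP : block_idempotent b.

Let Kb : fixed K b. Proof. by case: bP => -[]. Qed.
Let bb : b * b = b. Proof. by case: bP => -[]. Qed.
Let bZ a : b * a = a * b. Proof. by case: bP => _; apply. Qed.
Let sKH : K \subset H. Proof. exact: normal_sub (ia_normal A1). Qed.
Let nHK : H \subset 'N(K). Proof. exact: normal_norm (ia_normal A1). Qed.
Let Pb : fixed P b. Proof. by move=> q /(fintype.subsetP sPK); exact: Kb. Qed.

Lemma corner_axioms1 : corner_axioms extGrading K (to_ext b) (stabG b) (stabH b).
Proof.
apply: tensor_corner_axioms => //.
- by apply/fintype.subsetP=> x; rewrite inE => /andP[].
- by apply/fintype.subsetP=> x; rewrite inE => /andP[xH _]; exact: (fintype.subsetP nHK).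
- by move=> x; rewrite inE => /andP[_ /eqP].
Qed.

Lemma corner_axioms2 :
  corner_axioms RPgrading 'N_K(P)%G bbarR (CHbbar / 'C_K(P))%G NHbbar.
Proof.
have FNK : fixed 'N_K(P) bbar.
  move=> q /setIP[qK qN]; have qNH : q \in 'N_H(P).
    by rewrite inE (fintype.subsetP sKH).
  by rewrite [LHS]Br_act // Kb.
have sN : NHbbar \subset 'N_H(P).
  by apply/fintype.subsetP=> x; rewrite inE => /andP[].
apply: tensor_corner_axioms => //.
- exact: finset.setSI.
- apply: (fintype.subset_trans sN); apply: normsI.
    exact: fintype.subset_trans (finset.subsetIl _ _) nHK.
  exact: fintype.subset_trans (finset.subsetIr _ _) (normG _).
- by rewrite -[LHS]BrM // bb.
- by move=> a; have [x Fx ->] := Br_surj a; rewrite -[LHS]BrM // -[RHS]BrM // bZ.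
- by move=> x; rewrite inE => /andP[_ /eqP].
move=> q qC; apply: FNK; case/setIP: qC => qK qC.
by rewrite inE qK (fintype.subsetP (cent_sub P)).
Qed.

Lemma corner_axioms3 : corner_axioms APgrading 'N_K(P)%G bbarA (stabG b) NHb.
Proof.
have [_ sHb _ sGr ee Fe e1 eC eN NGr] := corner_axioms1.
have Pe : fixed P (to_ext b) by move=> q /(fintype.subsetP sPK); exact: Fe.
have sN : NHb \subset 'N_H(P).
  by apply/fintype.subsetP=> x; rewrite inE => /andP[].
have sNHb h : h \in NHb -> h \in stabH b.
  by rewrite !inE => /andP[/andP[-> _] ->].
split=> //.
- exact: finset.setSI.
- apply: (fintype.subset_trans sN); apply: normsI.
    exact: fintype.subset_trans (finset.subsetIl _ _) nHK.
  exact: fintype.subset_trans (finset.subsetIr _ _) (normG _).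
- by rewrite -[LHS]BrM // ee.
- move=> q /setIP[qK qN]; have qNH : q \in 'N_H(P).
    by rewrite inE (fintype.subsetP sKH).
  by rewrite [LHS]Br_act // Fe.
- by exists (to_ext b).
- move=> s u sG [v [Fv cv ->]].
  by rewrite -[LHS]BrM // -[RHS]BrM // (eC _ _ sG cv).
- move=> h hN; rewrite [LHS]Br_act ?(fintype.subsetP sN) //.
  by rewrite eN // sNHb.
by move=> h /sNHb; exact: NGr.
Qed.

Definition ext1 : extension gT := hU_extension corner_axioms1.
Definition ext2 : extension gT := hU_extension corner_axioms2.
Definition ext3 : extension gT := hU_extension corner_axioms3.

Definition C1 : pzRingType := unitAlg1 corner_axioms1.

End Defect.
End Setting.

Definition discrete_valuation_ring (O : idomainType) : Prop :=
  exists pi : O, [/\ pi != 0, pi \isn't a GRing.unit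
    & forall x, x != 0 -> exists u n, u \is a GRing.unit /\ x = u * pi ^+ n].

Definition is_field (O : idomainType) : Prop :=
  forall x : O, x != 0 -> x \is a GRing.unit.

(* Main.v *)
Require Import Defs.
From mathcomp Require Import all_boot all_fingroup all_algebra pgroup.
From mathcomp Require boolp.
Import Defs.

(** The Brauer map Br_P is a ring morphism A^P -> A(P) which respects the grading
    and the action of N_H(P), and it carries C_s = b(A_s)^K to
    E_s = Br_P(b)(A(P)_s)^(N_K(P)). Everything rests on its being onto here.
    By Mackey's formula Br_P(Tr_P^K(a)) = Tr(Br_P(a)), the second trace being
    from P to N_K(P) ([Br_reltr]). Write b = Tr_P^K(c). If Br_P(u) is fixed by
    N_K(P), then Br_P(Tr_P^K(cu)) = Br_P(b) Br_P(u) ([Br_corner_onto]).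

    The ring C_1 is local and Br_P(b) is nonzero, so an element of C_1 whose
    image lies in J(E_1) lies in J(C_1). An equation for Br_P(b) in
    E_s E_(s^-1) therefore lifts to a unit of C_1 in C_s C_(s^-1), whence
    G[b] = G[bbar] ([supp_b_bbar]). Dividing by C J(C_1) and E J(E_1) yields a
    morphism of extensions (1) -> (3). It is onto because inverses lift. Its
    kernel lies in degree 1, and it is trivial because E J(E_1) meets E_1 in
    J(E_1) only ([AP_jac_degree1]). This last point needs the projection of
    A(P) on its component of degree 1, which is A_1(P).

    For extension (2), a (x) x |-> ax defines a graded morphism from
    R = A_1(P) (x) kC_H(P) to A(P), which is an isomorphism from R_1 onto
    A(P)_1. It thus induces an isomorphism D_1 -> E_1, and the same argument
    shows that the morphism of extensions (2) -> (3) is injective. The passage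
    from graded morphisms to morphisms of extensions is common to both cases
    ([cm_hU_monomorphism], [cm_hU_surj]).

    Finally, an element h of H that fixes b makes P^h another defect group of
    b, hence a conjugate of P in K, again by Mackey's formula
    ([brauer_trace_conj]). So H_b = N_H(P)_b K ([stabH_frattini]). The
    stabilizers of b and Br_P(b) in N_H(P) agree because b is primitive and
    central ([NHb_bbar]). *)

Set Implicit Arguments.
Unset Strict Implicit.
Unset Printing Implicit Defensive.

Import GRing.Theory.
Local Open Scope group_scope.
Local Open Scope ring_scope.

(** * Morphisms of crossed products *)

Section SpanTheory.
Variables (V : zmodType) (S : V -> Prop).

Lemma spanN x : span S x -> span S (- x).
Proof. by move=> Sx; rewrite -sub0r; apply: SpanB => //; exact: Span0. Qed.

Lemma spanD x y : span S x -> span S y -> span S (x + y).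
Proof. by move=> Sx Sy; rewrite -[y]opprK; apply: SpanB => //; exact: spanN. Qed.

Lemma span_sum (I : Type) (r : seq I) (P : pred I) (F : I -> V) :
  (forall i, P i -> span S (F i)) -> span S (\sum_(i <- r | P i) F i).
Proof.
by move=> SF; apply: (big_ind (span S)) => //; [exact: Span0|exact: spanD].
Qed.

End SpanTheory.

Section Corner1.
Variables (O : pzRingType) (gT : finGroupType) (X : {group gT}) (A : actAlg O X).
Variables (L : {group gT}) (g : grading A L) (F : {group gT}) (e : A).
Variables (Gr : {group coset_of L}) (N : {group gT}) (ax : corner_axioms g F e Gr N).

Lemma cornerM s t x y : s \in Gr -> t \in Gr ->
  corner g F e s x -> corner g F e t y -> corner g F e (s * t)%g (x * y).
Proof.
move=> sG tG [u [cu Fu ->]] [v [cv Fv ->]]; exists (u * v); split.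
- by apply: grM => //; apply: (fintype.subsetP (ca_Gr ax)).
- move=> q qF; rewrite actMr ?Fu ?Fv //.
  exact: (fintype.subsetP (ca_F ax)).
by rewrite -mulrA (mulrA u) -(ca_comm ax sG cu) !mulrA (ca_ee ax).
Qed.

Lemma corner_crossed s x :
  s \in corner_support g F e Gr -> corner g F e s x -> crossed_set g F e Gr x.
Proof. by move=> sG Cx; apply: SpanIn; exists s. Qed.

Lemma corner_gr s x : s \in Gr -> corner g F e s x -> gr_comp g s x.
Proof.
move=> sG /(cornerP ax _ sG)[[u cu ->] _]; rewrite -[s]mul1g.
by apply: grM (ca_1e ax) cu => //; apply: (fintype.subsetP (ca_Gr ax)).
Qed.

Lemma corner1_e : corner g F e 1%g e.
Proof. exact: (sa1 (unitSubalg ax)). Qed.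

Lemma corner1M x y :
  corner g F e 1%g x -> corner g F e 1%g y -> corner g F e 1%g (x * y).
Proof. exact: (saM (s := unitSubalg ax)). Qed.

Lemma corner1B x y :
  corner g F e 1%g x -> corner g F e 1%g y -> corner g F e 1%g (x - y).
Proof. exact: (saB (s := unitSubalg ax)). Qed.

Lemma mulspan_corner1 s z : s \in Gr ->
  mulspan (corner g F e s) (corner g F e s^-1%g) z -> corner g F e 1%g z.
Proof.
move=> sG; elim=> [_ [x [y [Cx Cy ->]]]||u v _ Cu _ Cv].
- by rewrite -(mulgV s); apply: cornerM; rewrite ?groupV.
- by rewrite -(subrr e); apply: corner1B; exact: corner1_e.
exact: corner1B.
Qed.

Lemma mulspan_cornerMr s z y : s \in Gr -> corner g F e 1%g y ->
  mulspan (corner g F e s) (corner g F e s^-1%g) z ->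
  mulspan (corner g F e s) (corner g F e s^-1%g) (z * y).
Proof.
move=> sG Cy; elim=> [_ [x [w [Cx Cw ->]]]||u v _ Hu _ Hv].
- apply: SpanIn; exists x, (w * y); rewrite mulrA; split=> //.
  by rewrite -[(s^-1)%g]mulg1; apply: cornerM; rewrite ?groupV.
- by rewrite mul0r; exact: Span0.
by rewrite mulrBl; exact: SpanB.
Qed.

(** Only the products cj with c of degree 1 contribute to the degree 1 part of
    an element of C J(C_1), and these lie in J(C_1). This needs the grading to
    be direct at degree 1, which the map [delta], injective on the component of
    degree 1 and zero on the others, expresses. *)
Lemma jac_degree1 (V : zmodType) (delta : A -> V) :
    (forall x y, delta (x - y) = delta x - delta y) ->
    (forall s x, s \in Gr -> s <> 1%g -> gr_comp g s x -> delta x = 0) ->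
    (forall x, gr_comp g 1%g x -> delta x = 0 -> x = 0) ->
  forall x, corner g F e 1%g x -> mulspan (crossed_set g F e Gr) (jac1 ax) x -> jac1 ax x.
Proof.
move=> deltaB delta0 delta1 x Cx Jx.
have J0 : jac1 ax 0 by exists 0 => //; exact: jacobson0.
have JB u v : jac1 ax u -> jac1 ax v -> jac1 ax (u - v).
  by case=> i Ji -> [j Jj ->]; exists (i - j) => //; exact: jacobsonB.
have JC j : jac1 ax j -> corner g F e 1%g j.
  by case=> i _ ->; exact: (sub_valP (S := unitSubalg ax)).
have d0 : delta 0 = 0 by rewrite -(subrr (0 : A)) deltaB subrr.
suff [j [Jj Ej]] : exists j, jac1 ax j /\ delta x = delta j.
  suff -> : x = j by [].
  apply/eqP; rewrite -subr_eq0; apply/eqP/delta1; last by rewrite deltaB Ej subrr.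
  by apply: corner_gr (group1 Gr) _; apply: corner1B => //; exact: JC.
elim: Jx => [_ [c [j [Cc Jj ->]]]||u v _ [i [Ji Eu]] _ [j [Jj Ev]]].
- elim: Cc => [{}c [s sG Cc]||u v _ [i [Ji Eu]] _ [l [Jl Ev]]].
  + have /(corner_supportP ax)[sGr _] := sG.
    have [E|/eqP s1] := eqVneq s 1%g.
      have [j' Jj' Ej] := Jj; rewrite E in Cc.
      exists (c * j); split=> //; exists (sub_in (S := unitSubalg ax) Cc * j').
        exact: jacobsonMl.
      by rewrite Ej.
    exists 0; split=> //; rewrite d0; apply: (delta0 s) => //.
    by apply: corner_gr => //; rewrite -[s]mulg1; apply: cornerM => //; exact: JC.
  + by exists 0; rewrite mul0r.
  + by exists (i - l); split; [exact: JB|rewrite mulrBl !deltaB Eu Ev].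
- by exists 0.
by exists (i - j); split; [exact: JB|rewrite !deltaB Eu Ev].
Qed.

End Corner1.

(** The map is required to be additive and multiplicative on a subset [D] only,
    because the Brauer map is meaningful on P-fixed points only. The grading
    groups may differ: [c] relates C_H(P)/C_K(P) to H/K in the application. *)
Record corner_morphism (O : pzRingType) (gT : finGroupType)
    (X : {group gT}) (A : actAlg O X) (L : {group gT}) (g : grading A L)
    (F : {group gT}) (e : A) (Gr : {group coset_of L})
    (X' : {group gT}) (A' : actAlg O X') (L' : {group gT}) (g' : grading A' L')
    (F' : {group gT}) (e' : A') (Gr' : {group coset_of L'})
    (D : A -> Prop) (psi : A -> A') (c : coset_of L -> coset_of L') : Prop :=
  CornerMorphism {
  cmDB : forall x y, D x -> D y -> D (x - y);
  cmDM : forall x y, D x -> D y -> D (x * y);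
  cmB : forall x y, D x -> D y -> psi (x - y) = psi x - psi y;
  cmM : forall x y, D x -> D y -> psi (x * y) = psi x * psi y;
  cm_e : psi e = e';
  cmD : forall s x, s \in Gr -> corner g F e s x -> D x;
  cm_corner : forall s x, s \in Gr -> corner g F e s x -> corner g' F' e' (c s) (psi x);
  cm_Gr : forall s, s \in Gr -> c s \in Gr';
  cm_degM : {in Gr &, {morph c : s t / (s * t)%g}}
}.

Section CornerMorphismTheory.
Variables (O : pzRingType) (gT : finGroupType).
Variables (X : {group gT}) (A : actAlg O X) (L : {group gT}) (g : grading A L).
Variables (F : {group gT}) (e : A) (Gr : {group coset_of L}) (N : {group gT}).
Variable ax : corner_axioms g F e Gr N.
Variables (X' : {group gT}) (A' : actAlg O X') (L' : {group gT}) (g' : grading A' L').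
Variables (F' : {group gT}) (e' : A') (Gr' : {group coset_of L'}) (N' : {group gT}).
Variable ax' : corner_axioms g' F' e' Gr' N'.
Variables (D : A -> Prop) (psi : A -> A') (c : coset_of L -> coset_of L').
Hypothesis cm : corner_morphism g F e Gr g' F' e' Gr' D psi c.

Local Notation C_ := (corner g F e).
Local Notation C'_ := (corner g' F' e').
Local Notation Gam := (corner_support g F e Gr).
Local Notation Gam' := (corner_support g' F' e' Gr').

Let D1 x : C_ 1%g x -> D x. Proof. by move=> Cx; apply: (cmD cm (group1 Gr) Cx). Qed.
Let De : D e. Proof. exact: D1 (corner1_e ax). Qed.
Let D0 : D 0. Proof. by rewrite -(subrr e); apply: (cmDB cm). Qed.
Let psi0 : psi 0 = 0. Proof. by rewrite -(subrr e) (cmB cm) ?subrr. Qed.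
Let c1 : c 1%g = 1%g.
Proof. by apply: (mulgI (c 1%g)); rewrite -(cm_degM cm) ?group1 // !mulg1. Qed.
Let cV s : s \in Gr -> c s^-1%g = (c s)^-1%g.
Proof.
by move=> sG; apply: (mulgI (c s)); rewrite -(cm_degM cm) ?groupV // !mulgV c1.
Qed.

(** A multiplicative map carries an equation 1 = sum x_i y_i with x_i in C_s and
    y_i in C_(s^-1) to an equation of the same kind. *)
Lemma cm_support s : s \in Gam -> c s \in Gam'.
Proof.
case/(corner_supportP ax) => sG He; apply/(corner_supportP ax').
split; first exact: (cm_Gr cm sG).
suff [] : D e /\ mulspan (C'_ (c s)) (C'_ (c s)^-1%g) (psi e) by rewrite (cm_e cm).
elim: He => [_ [x [y [Cx Cy ->]]]||x y _ [Dx Hx] _ [Dy Hy]].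
- have sVG : (s^-1)%g \in Gr by rewrite groupV.
  have Dx := cmD cm sG Cx; have Dy := cmD cm sVG Cy.
  split; first exact: (cmDM cm).
  apply: SpanIn; exists (psi x), (psi y); rewrite (cmM cm) //; split=> //.
    exact: (cm_corner cm).
  by rewrite -cV //; apply: (cm_corner cm).
- by rewrite psi0; split=> //; exact: Span0.
by split; [apply: (cmDB cm)|rewrite (cmB cm) //; exact: SpanB].
Qed.

Lemma cm_crossed x : crossed_set g F e Gr x -> D x /\ crossed_set g' F' e' Gr' (psi x).
Proof.
elim=> [{}x [s sG Cx]||u v _ [Du Hu] _ [Dv Hv]].
- have /(corner_supportP ax)[sGr _] := sG.
  split; first exact: (cmD cm sGr Cx).
  exact: (corner_crossed (cm_support sG) (cm_corner cm sGr Cx)).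
- by rewrite psi0; split=> //; exact: Span0.
by split; [apply: (cmDB cm)|rewrite (cmB cm) //; exact: SpanB].
Qed.

Hypothesis psi_onto1 : forall y, C'_ 1%g y -> exists2 x, C_ 1%g x & psi x = y.

(** The radical consists of the j with 1 - aj left invertible for every a, a
    condition that passes to the image because every a of E_1 lifts to C_1. *)
Lemma cm_jac1 x : jac1 ax x -> jac1 ax' (psi x).
Proof.
case=> j /jacobsonP Jj ->.
have Cj := sub_valP (S := unitSubalg ax) j; have Dj := D1 Cj.
have C'j : C'_ 1%g (psi (val j)) by rewrite -c1; apply: (cm_corner cm).
exists (sub_in (S := unitSubalg ax') C'j) => //; apply/jacobsonP => a'.
have [a Ca Ea] := psi_onto1 (sub_valP (S := unitSubalg ax') a').
have [u /(congr1 val) /= E] := Jj (sub_in (S := unitSubalg ax) Ca).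
have Cu := sub_valP (S := unitSubalg ax) u; have Du := D1 Cu.
have C'u : C'_ 1%g (psi (val u)) by rewrite -c1; apply: (cm_corner cm).
exists (sub_in (S := unitSubalg ax') C'u); apply: val_inj => /=.
have Da := D1 Ca; have Daj := cmDM cm Da Dj.
by rewrite -Ea -(cm_e cm) -(cmM cm) // -(cmB cm) // -(cmM cm) // ?E //; apply: (cmDB cm).
Qed.

Lemma cm_jac x : mulspan (crossed_set g F e Gr) (jac1 ax) x ->
  D x /\ mulspan (crossed_set g' F' e' Gr') (jac1 ax') (psi x).
Proof.
elim=> [_ [y [j [Cy Jj ->]]]||u v _ [Du Hu] _ [Dv Hv]].
- have [Dy C'y] := cm_crossed Cy.
  have Dj : D j.
    by case: (Jj) => j' _ ->; apply: D1; exact: (sub_valP (S := unitSubalg ax)).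
  split; first exact: (cmDM cm).
  rewrite (cmM cm) //; apply: SpanIn; exists (psi y), (psi j).
  by split=> //; exact: cm_jac1.
- by rewrite psi0; split=> //; exact: Span0.
by split; [apply: (cmDB cm)|rewrite (cmB cm) //; exact: SpanB].
Qed.

(** In a local ring, an element a x outside J(C_1) is a unit; so is then its
    image, which is impossible if that image lies in J(E_1). *)
Lemma cm_reflect_local : local_ring (unitAlg1 ax) -> e' <> 0 ->
  forall x, C_ 1%g x -> jac1 ax' (psi x) -> jac1 ax x.
Proof.
case=> _ loc e'0 x Cx [j' Jj' Ej].
exists (sub_in (S := unitSubalg ax) Cx) => //; apply/jacobsonP => a.
set y := a * _; case: (loc (1 - y) y) => [|[u [_ u1]]|[u [_ uy]]].
- by rewrite subrK; exists 1; rewrite mulr1.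
- by exists u.
have /jacobsonP/(_ 1) [v] : jacobson (1 : unitAlg1 ax').
  have Da := sub_valP (S := unitSubalg ax) a; have Du := sub_valP (S := unitSubalg ax) u.
  have := cm_corner cm (group1 Gr) (corner1M ax Du Da).
  rewrite c1 => Cua.
  have -> : (1 : unitAlg1 ax') = sub_in (S := unitSubalg ax') Cua * j'.
    apply: val_inj; rewrite /= -Ej -(cm_e cm).
    rewrite -(cmM cm (D1 (corner1M ax Du Da)) (D1 Cx)) -mulrA; congr psi.
    exact: esym (congr1 val uy).
  exact: jacobsonMl.
rewrite mul1r subrr mulr0 => /(congr1 val) /= E0; case: e'0.
by rewrite -E0.
Qed.

(** Here [psi] is an isomorphism from C_1 onto E_1. *)
Lemma cm_reflect_inj :
    (forall x y, C_ 1%g x -> C_ 1%g y -> psi x = psi y -> x = y) ->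
  forall x, C_ 1%g x -> jac1 ax' (psi x) -> jac1 ax x.
Proof.
move=> inj x Cx [j' /jacobsonP Jj' Ej].
exists (sub_in (S := unitSubalg ax) Cx) => //; apply/jacobsonP => a.
have Ca := sub_valP (S := unitSubalg ax) a.
have := cm_corner cm (group1 Gr) Ca; rewrite c1 => C'a.
have [u' /(congr1 val) /= E] := Jj' (sub_in (S := unitSubalg ax') C'a).
have [u Cu Eu] := psi_onto1 (sub_valP (S := unitSubalg ax') u').
exists (sub_in (S := unitSubalg ax) Cu); apply: val_inj => /=.
have Cax : C_ 1%g (sval a * x) by apply: (corner1M ax).
have Ceax : C_ 1%g (e - sval a * x).
  by apply: (corner1B ax) => //; exact: (corner1_e ax).
apply: inj; [|exact: (corner1_e ax)|].
  by apply: (corner1M ax).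
rewrite (cmM cm (D1 Cu) (D1 Ceax)) (cmB cm De (D1 Cax)) (cmM cm (D1 Ca) (D1 Cx)).
by rewrite (cm_e cm) Ej Eu.
Qed.

Definition cm_in (u : crossedAlg ax) : crossedAlg ax' :=
  sub_in (S := crossedSubalg ax')
    (proj2 (cm_crossed (sub_valP (S := crossedSubalg ax) u))).

Definition cm_bar (q : barAlg ax) : barAlg ax' :=
  quot_pi (jacIdeal ax') (cm_in (generic_quotient.repr (q : quot_type (jacIdeal ax)))).

Let Dval (u : crossedAlg ax) : D (sval u).
Proof. by case: (cm_crossed (sub_valP (S := crossedSubalg ax) u)). Qed.

Lemma cm_bar_pi (u : crossedAlg ax) :
  cm_bar (quot_pi (jacIdeal ax) u) = quot_pi (jacIdeal ax') (cm_in u).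
Proof.
apply/quot_piE; have := quot_repr (jacIdeal ax) u.
set v := generic_quotient.repr _; move=> Jvu.
have [_ Hvu] := cm_jac Jvu; by move: Hvu; rewrite /= (cmB cm) ?Dval.
Qed.

Lemma cm_bar1 : cm_bar 1 = 1.
Proof.
by rewrite [LHS]cm_bar_pi; congr quot_pi; apply: val_inj; rewrite /= (cm_e cm).
Qed.

Lemma cm_barM q r : cm_bar (q * r) = cm_bar q * cm_bar r.
Proof.
elim/quot_ind: q => u; elim/quot_ind: r => v.
rewrite [X in cm_bar X]quot_piM !cm_bar_pi [RHS]quot_piM; congr quot_pi.
by apply: val_inj; rewrite /= (cmM cm) ?Dval.
Qed.

Lemma cm_bar_comp s q : s \in Gam -> bar_comp s q -> bar_comp (c s) (cm_bar q).
Proof.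
case/(corner_supportP ax) => sG _ [u [Cu ->]]; exists (cm_in u).
by rewrite cm_bar_pi; split=> //; apply: (cm_corner cm).
Qed.

Lemma cm_is_hunit (x : barAlg ax * coset_of L) :
  is_hunit x -> is_hunit (cm_bar x.1, c x.2).
Proof.
case=> xG Cx [v [Cv xv vx]]; have /(corner_supportP ax)[xGr _] := xG.
split=> /=; [exact: cm_support|exact: cm_bar_comp|exists (cm_bar v); split].
- by rewrite -cV //; apply: cm_bar_comp => //; rewrite (groupV (corner_support_group ax)).
- by rewrite -cm_barM xv cm_bar1.
- by rewrite -cm_barM vx cm_bar1.
Qed.

Definition cm_hU (u : hU_extension ax) : hU_extension ax' :=
  hunit_in (cm_is_hunit (hunitP (u : hunit ax))).

Lemma cm_hU_morphism : ext_morphism cm_hU c.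
Proof.
split=> [u v|s t sG tG|s|u] //; last exact: cm_support.
- apply: val_inj; congr (_, _); first exact: cm_barM.
  have [uG _ _] := hunitP (u : hunit ax); have [vG _ _] := hunitP (v : hunit ax).
  by case/(corner_supportP ax): uG => uG _; case/(corner_supportP ax): vG => vG _;
    apply: (cm_degM cm).
by case/(corner_supportP ax): sG => sG _; case/(corner_supportP ax): tG => tG _;
  apply: (cm_degM cm).
Qed.

Hypothesis jac_homog : forall x, C'_ 1%g x ->
  mulspan (crossed_set g' F' e' Gr') (jac1 ax') x -> jac1 ax' x.
Hypothesis psi_reflect : forall x, C_ 1%g x -> jac1 ax' (psi x) -> jac1 ax x.

Let jac1_mulspan x : jac1 ax x -> mulspan (crossed_set g F e Gr) (jac1 ax) x.
Proof.
move=> Jx; have [j _ Ej] := Jx.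
apply: SpanIn; exists e, x; split=> //.
  apply: (@corner_crossed _ _ _ _ _ _ _ _ _ 1%g).
    exact: (group1 (corner_support_group ax)).
  exact: (corner1_e ax).
by rewrite Ej (sa1M (sub_valP (S := unitSubalg ax) j)).
Qed.

(** Triviality is reflected in degree 1: a preimage of 1 differs from the
    identity by an element whose image lies in E J(E_1), hence in J(E_1) by
    [jac_homog], hence by an element of J(C_1). *)
Lemma cm_bar_reflect1 (u : crossedAlg ax) :
  C_ 1%g (val u) -> cm_bar (quot_pi (jacIdeal ax) u) = 1 ->
  quot_pi (jacIdeal ax) u = 1 :> barAlg ax.
Proof.
move=> Cu; rewrite cm_bar_pi => /quot_piE/jac_homog /= Hu.
apply/quot_piE; rewrite /= /jac_set /=; apply: jac1_mulspan.
have Ce := corner1_e ax; have Cue := corner1B ax Cu Ce.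
apply: psi_reflect => //; rewrite (cmB cm (Dval u) De) (cm_e cm); apply: Hu.
rewrite -[X in C'_ X]c1; have := cm_corner cm (group1 Gr) Cue.
by rewrite (cmB cm (Dval u) De) (cm_e cm).
Qed.

Hypothesis c_inj : {in Gam &, injective c}.

(** Since [c] is injective, the kernel lies in degree 1. *)
Lemma cm_hU_inj : injective cm_hU.
Proof.
move=> u v Euv; apply: (can_inj (mulgK (v^-1)%g)); rewrite mulgV.
set w := (u * v^-1)%g.
have fw : cm_hU w = 1%g.
  have [fM _ _ _] := cm_hU_morphism.
  have f1 : cm_hU 1%g = 1%g by apply: (mulgI (cm_hU 1%g)); rewrite -fM !mulg1.
  by rewrite fM Euv -fM mulgV f1.
have [wG [w0 [Cw0 Ew]] _] := hunitP (w : hunit ax).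
have dw : (val (w : hunit ax)).2 = 1%g.
  apply: c_inj => //; first exact: (group1 (corner_support_group ax)).
  by rewrite c1; have := congr1 (fun z : hunit ax' => (val z).2) fw.
apply: val_inj; rewrite [LHS]surjective_pairing; congr (_, _) => //.
rewrite dw in Cw0.
rewrite Ew; apply: cm_bar_reflect1 => //; rewrite -Ew.
by have := congr1 (fun z : hunit ax' => (val z).1) fw.
Qed.

Lemma cm_hU_monomorphism : ext_monomorphism cm_hU c.
Proof. by split; [exact: cm_hU_morphism|exact: cm_hU_inj|exact: c_inj]. Qed.

Lemma cm_hU_equivariant (N0 : {set gT}) :
    N0 \subset N -> N0 \subset N' ->
    (forall h x, h \in N0 -> D x -> act (psi x) h = psi (act x h)) ->
    (forall h s, h \in N0 -> s \in Gam -> c (s ^ coset L h) = (c s) ^ coset L' h)%g ->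
  ext_equivariant N0 cm_hU.
Proof.
move=> /fintype.subsetP sN /fintype.subsetP sN' psiJ cJ h u hN0.
have hN := sN _ hN0; have hN' := sN' _ hN0.
have [uG _ _] := hunitP (u : hunit ax).
have barJ (q : barAlg ax) : cm_bar (act q h) = act (cm_bar q) h.
  elim/quot_ind: q => x; rewrite [X in cm_bar X](quot_pi_act (jacIdeal ax)) //.
  rewrite !cm_bar_pi [RHS](quot_pi_act (jacIdeal ax')) //; congr quot_pi.
  apply: val_inj; rewrite [RHS]val_sub_act // [RHS]psiJ //; last exact: Dval.
  by congr psi; exact: val_sub_act.
apply: val_inj; rewrite /= val_hu_act // /hu_val /hu_deg /= val_hu_act //=.
by congr (_, _); [exact: barJ|exact: cJ].
Qed.

(** Lift a homogeneous unit and its inverse to x and t; both xt and tx are of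
    degree 1 and have image 1, so that they equal 1 modulo the radical. *)
Lemma cm_hU_surj :
    (forall s y, s \in Gr -> C'_ (c s) y -> exists2 x, C_ s x & psi x = y) ->
    (forall t, t \in Gam' -> exists2 s, s \in Gam & c s = t) ->
  forall v, exists u, cm_hU u = v.
Proof.
move=> onto c_onto v.
have [vG [y [Cy Ey]] [w [[z [Cz ->]] Eyz Ezy]]] := hunitP (v : hunit ax').
have [s sG Es] := c_onto _ vG; have /(corner_supportP ax)[sGr _] := sG.
have sVG : (s^-1)%g \in Gam by rewrite (groupV (corner_support_group ax)).
have /(corner_supportP ax)[sVGr _] := sVG.
rewrite -Es in Cy Cz; rewrite -cV // in Cz.
have [x0 Cx0 Ex] := onto _ _ sGr Cy; have [t0 Ct0 Et] := onto _ _ sVGr Cz.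
pose x : crossedAlg ax := sub_in (S := crossedSubalg ax) (corner_crossed sG Cx0).
pose t : crossedAlg ax := sub_in (S := crossedSubalg ax) (corner_crossed sVG Ct0).
have fx : cm_bar (quot_pi (jacIdeal ax) x) = (val (v : hunit ax')).1.
  by rewrite Ey cm_bar_pi; congr quot_pi; apply: val_inj.
have ft : cm_bar (quot_pi (jacIdeal ax) t) = quot_pi (jacIdeal ax') z.
  by rewrite cm_bar_pi; congr quot_pi; apply: val_inj.
have hx : is_hunit (quot_pi (jacIdeal ax) x : barAlg ax, s).
  split=> //=; first by exists x.
  exists (quot_pi (jacIdeal ax) t : barAlg ax); split; first by exists t.
    rewrite [LHS](quot_piM (jacIdeal ax)); apply: cm_bar_reflect1.
      by rewrite /= -(mulgV s); apply: (cornerM ax).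
    rewrite -[X in cm_bar X](quot_piM (jacIdeal ax)).
    by rewrite [LHS]cm_barM fx ft.
  rewrite [LHS](quot_piM (jacIdeal ax)); apply: cm_bar_reflect1.
    by rewrite /= -(mulVg s); apply: (cornerM ax).
  rewrite -[X in cm_bar X](quot_piM (jacIdeal ax)).
  by rewrite [LHS]cm_barM fx ft.
exists (hunit_in hx); apply: val_inj; rewrite [RHS]surjective_pairing /=.
by congr (_, _).
Qed.

End CornerMorphismTheory.

(** * The Brauer map on relative traces *)

Section BrauerTrace.
Variables (O k : pzRingType) (res : {rmorphism O -> k}).
Variables (gT : finGroupType) (M H : {group gT}) (A : interiorAlg O M H).
Variables (P : {group gT}) (sPH : P \subset H).
Implicit Types (d : A) (Q R : {group gT}).

Lemma Br_eq (x y : A) : fixed P x -> fixed P y ->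
  Br res sPH x = Br res sPH y <-> span (brauer_gen res P) (x - y).
Proof.
move=> Fx Fy; rewrite -[x]/(val (sub_in (S := fixedSubalg A sPH) Fx)).
by rewrite -[y]/(val (sub_in (S := fixedSubalg A sPH) Fy)) !BrE; exact: quot_piE.
Qed.

Lemma fixed_sub Q R (x : A) : Q \subset R -> fixed R x -> fixed Q x.
Proof. by move=> /fintype.subsetP sQR Fx q /sQR; exact: Fx. Qed.

Lemma fixed0 R : R \subset H -> fixed R (0 : A).
Proof. by move=> /fintype.subsetP sRH q /sRH qH; rewrite act0. Qed.

Lemma fixedD R (x y : A) : R \subset H -> fixed R x -> fixed R y -> fixed R (x + y).
Proof. by move=> /fintype.subsetP sRH Fx Fy q qR; rewrite actD ?sRH // Fx // Fy. Qed.

Lemma fixedB R (x y : A) : R \subset H -> fixed R x -> fixed R y -> fixed R (x - y).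
Proof. by move=> /fintype.subsetP sRH Fx Fy q qR; rewrite actB ?sRH // Fx // Fy. Qed.

Lemma fixedM R (x y : A) : R \subset H -> fixed R x -> fixed R y -> fixed R (x * y).
Proof. by move=> /fintype.subsetP sRH Fx Fy q qR; rewrite actMr ?sRH // Fx // Fy. Qed.

Lemma fixed_sum R (I : Type) (r : seq I) (B : pred I) (E : I -> A) : R \subset H ->
  (forall i, B i -> fixed R (E i)) -> fixed R (\sum_(i <- r | B i) E i).
Proof.
move=> sRH FE; apply: (big_ind (fixed R)) => //; first exact: fixed0.
by move=> x y; exact: fixedD.
Qed.

Lemma Br0 : Br res sPH (0 : A) = 0.
Proof. by rewrite -(subrr (0 : A)) BrB ?subrr //; exact: fixed0. Qed.

Lemma BrD (x y : A) : fixed P x -> fixed P y -> Br res sPH (x + y) = Br res sPH x + Br res sPH y.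
Proof.
move=> Fx Fy; have F0 := fixed0 sPH.
have FN : fixed P (- y) by rewrite -sub0r; exact: fixedB.
have EN : Br res sPH (- y) = - Br res sPH y by rewrite -sub0r BrB // Br0 sub0r.
by rewrite -{1}[y]opprK BrB // EN opprK.
Qed.

Lemma Br_sum (I : finType) (B : pred I) (E : I -> A) :
    (forall i, B i -> fixed P (E i)) ->
  Br res sPH (\sum_(i | B i) E i) = \sum_(i | B i) Br res sPH (E i).
Proof.
move=> FE; suff [] : fixed P (\sum_(i | B i) E i) /\
  Br res sPH (\sum_(i | B i) E i) = \sum_(i | B i) Br res sPH (E i) by [].
apply: (big_ind2 (fun x (q : brauerAct res A sPH) => fixed P x /\ Br res sPH x = q)).
- by split; [exact: fixed0|exact: Br0].
- move=> x q y r [Fx <-] [Fy <-]; split; first exact: fixedD.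
  exact: BrD.
- by move=> i Bi; split=> //; exact: FE.
Qed.

Lemma fixed_reltr Q R d : R \subset H -> Q \subset R -> fixed Q d -> fixed R (reltr Q R d).
Proof.
move=> sRH sQR Fd r rR; have rN : r \in 'N_H(R).
  by rewrite inE (fintype.subsetP sRH) // (fintype.subsetP (normG R)).
rewrite /reltr act_sum ?(fintype.subsetP sRH) //.
rewrite [RHS](reindex_inj (@rcoset_inj _ r)) /=.
apply: eq_big => [C|C CR].
  apply/idP/idP => /rcosetsP[x xR E]; apply/rcosetsP.
    by exists (x * r)%g; rewrite ?groupM // E rcosetM.
  by exists (x * r^-1)%g; rewrite ?groupM ?groupV // rcosetM -E rcosetK.
have [x xR E] := rcosetsP CR; have xC : x \in C by rewrite E rcoset_refl.
rewrite (act_rcoset sRH sQR Fd CR xC).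
rewrite (act_rcoset (x := (x * r)%g) sRH sQR Fd).
- by rewrite (actMg _ (fintype.subsetP sRH _ xR) (fintype.subsetP sRH _ rR)).
- by apply/rcosetsP; exists (x * r)%g; rewrite ?groupM // E rcosetM.
by rewrite ?rcosetE mem_rcoset mulgK.
Qed.

(** Mackey's formula: the cosets Qx in R split into P-orbits, and the orbit of
    Qx contributes the trace to P from the stabilizer of Qx in P, which is
    killed by Br_P unless P fixes Qx. *)
Lemma mackey_brauer Q R d : R \subset H -> Q \subset R -> P \subset R -> fixed Q d ->
  span (brauer_gen res P)
    (reltr Q R d - \sum_(C in 'Fix_(rcosets Q R | 'Rs)(P)) act d (repr C)).
Proof.
move=> sRH sQR sPR Fd; set Z := 'Fix_(_ | _)(_)%g.
pose S := rcosets Q R :\: Z.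
have RH (x : gT) : x \in R -> x \in H by exact: (fintype.subsetP sRH).
have PR (x : gT) : x \in P -> x \in R by exact: (fintype.subsetP sPR).
have -> : reltr Q R d - \sum_(C in Z) act d (repr C) = \sum_(C in S) act d (repr C).
  have sZ : Z \subset rcosets Q R by exact: finset.subsetIl.
  by rewrite /reltr (big_setID Z) /= (finset.setIidPr sZ) addrAC subrr add0r.
have actsS : [acts P, on S | 'Rs].
  (* a coset fixed by P is its own translate by any u in P *)
  have fixE (C : {set gT}) v : v \in P -> C \in 'Fix_('Rs)(P) -> 'Rs%act C v = C.
    by move=> vP /afixP; exact.
  apply/actsP=> u uP C; rewrite !in_setD !in_setI.
  rewrite (actsP (actsRs_rcosets Q R) _ (PR _ uP)).
  case: (C \in rcosets Q R); rewrite ?andbF //= !andbT; congr (~~ _).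
  apply/idP/idP => FC; last by rewrite fixE.
  by rewrite -(action.actK 'Rs%act u C) fixE ?groupV.
rewrite (set_partition_big _ (orbit_partition actsS)) /=.
apply: span_sum => _ /imsetP[C CS ->].
have [CR CZ] : C \in rcosets Q R /\ C \notin Z by move: CS; rewrite inE => /andP[].
have [x xR EC] := rcosetsP CR.
have xC : x \in C by rewrite EC rcoset_refl.
pose T := 'C_P[C | 'Rs]%G.
have sTP : T \subset P by exact: finset.subsetIl.
have Fx : fixed T (act d x).
  move=> t tT; have tP : t \in P by exact: (fintype.subsetP sTP).
  have tH := RH _ (PR _ tP); have xH := RH _ xR.
  rewrite -actMg //.
  have xtC : (x * t)%g \in C.
    have /astab1P <- : t \in 'C[C | 'Rs]%g by case/setIP: tT.
    by rewrite /= rcosetE mem_rcoset mulgK.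
  by rewrite -(act_rcoset sRH sQR Fd CR xtC) (act_rcoset sRH sQR Fd CR xC).
apply: SpanIn; left; exists T; split.
  rewrite properE sTP; apply: contra CZ => sPT; rewrite in_setI CR.
  apply/afixP=> u uP; apply/astab1P.
  by case/setIP: (fintype.subsetP sPT _ uP).
exists (act d x) => //.
have sPT : P \subset [set: gT] by exact: finset.subsetT.
rewrite (orbit_stabilizer _ _ sPT) big_imset /=; last first.
  exact: can_in_inj (act_reprK (to := 'Rs) sPT).
apply: eq_bigr => D DT.
have rP : repr D \in P.
  have [y yP ->] := rcosetsP DT; case: (repr_rcosetP T y) => t tT.
  by rewrite groupM // (fintype.subsetP sTP).
have rR := PR _ rP.
rewrite -(actMg _ (RH _ xR) (RH _ rR)); apply: (act_rcoset sRH sQR Fd).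
  by rewrite /= rcosetE; apply/rcosetsP; exists (x * repr D)%g; rewrite ?groupM // EC rcosetM.
by rewrite ?rcosetE mem_rcoset mulgK.
Qed.

(** If P lies in no conjugate of Q then it fixes no coset of Q, and Mackey's
    formula leaves nothing. *)
Lemma brauer_trace_conj Q R d : R \subset H -> Q \subset R -> P \subset R -> fixed Q d ->
  Br res sPH (reltr Q R d) <> 0 -> exists2 x, x \in R & P \subset Q :^ x.
Proof.
move=> sRH sQR sPR Fd nz; have := mackey_brauer sRH sQR sPR Fd.
have Ftr : fixed P (reltr Q R d) by apply: fixed_sub sPR _; exact: fixed_reltr.
case: (set_0Vmem ('Fix_(rcosets Q R | 'Rs)(P))%g) => [->|[C /setIP[CR /afixP PC]] _].
  rewrite big_set0 => Sp; case: nz; rewrite -Br0; apply/Br_eq => //.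
  exact: fixed0.
have [x xR EC] := rcosetsP CR; exists x => //.
apply/fintype.subsetP => u uP; rewrite mem_conjg conjgE invgK.
have : (x * u)%g \in C.
  by rewrite -(PC _ uP) /= rcosetE mem_rcoset mulgK EC rcoset_refl.
by rewrite EC mem_rcoset mulgA.
Qed.

(** Mackey's formula with Q = P: the cosets Px that P fixes are those with x in
    N_R(P). *)
Lemma Br_reltr R d : R \subset H -> P \subset R -> fixed P d ->
  Br res sPH (reltr P R d) = reltr P 'N_R(P) (Br res sPH d : brauer res A sPH).
Proof.
move=> sRH sPR Fd; have sPN : P \subset 'N_R(P) by rewrite finset.subsetI sPR normG.
have RH (x : gT) : x \in R -> x \in H by exact: (fintype.subsetP sRH).
have fixE : 'Fix_(rcosets P R | 'Rs)(P) = rcosets P 'N_R(P).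
  apply/setP=> C; apply/setIP/rcosetsP => [[/rcosetsP[x xR ->] /afixP PC]|].
    exists x => //; rewrite inE xR; apply/normP/eqP.
    rewrite eq_sym eqEcard cardJg leqnn andbT; apply/fintype.subsetP=> u uP.
    rewrite mem_conjg conjgE invgK mulgA -mem_rcoset -(PC _ uP) /=.
    by rewrite rcosetE mem_rcoset mulgK rcoset_refl.
  case=> x /setIP[xR xN] ->; split; first by apply/rcosetsP; exists x.
  apply/afixP=> u uP /=; rewrite !rcosetE -rcosetM; apply/rcoset_eqP.
  by rewrite mem_rcoset -mulgA -{1}[x]invgK -conjgE memJ_norm ?groupV.
have dJ C : C \in rcosets P 'N_R(P) -> repr C \in 'N_H(P).
  case/rcosetsP=> y /setIP[yR yN] ->; case: (repr_rcosetP P y) => u uP.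
  have uR := fintype.subsetP sPR _ uP; have uN := fintype.subsetP (normG P) _ uP.
  by rewrite inE (RH _ (groupM uR yR)) (groupM uN yN).
have FdJ C : C \in rcosets P 'N_R(P) -> fixed P (act d (repr C)).
  by move=> CR; exact: (sa_act (s := fixedSubalg A sPH) (dJ _ CR) Fd).
transitivity (Br res sPH (\sum_(C in rcosets P 'N_R(P)) act d (repr C))).
  have Ftr := fixed_sub sPR (fixed_reltr sRH sPR Fd).
  apply/Br_eq => //; first exact: fixed_sum.
  by rewrite -fixE; apply: mackey_brauer.
rewrite Br_sum //; apply: eq_bigr => C CR.
by rewrite [RHS]Br_act // dJ.
Qed.

End BrauerTrace.

(** * Maps out of Brauer quotients and out of tensor products *)

Section BrauerFunctor.
Variables (O k : pzRingType) (res : {rmorphism O -> k}).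
Variables (gT : finGroupType) (M M' H : {group gT}).
Variables (A : interiorAlg O M H) (B : interiorAlg O M' H).
Variables (P : {group gT}) (sPH : P \subset H) (theta : A -> B).
Hypothesis thetaB : forall x y, theta (x - y) = theta x - theta y.
Hypothesis thetaZ : forall c x, theta (alg_scal A c * x) = alg_scal B c * theta x.
Hypothesis thetaJ : forall x h, h \in H -> theta (act x h) = act (theta x) h.

Let theta0 : theta 0 = 0. Proof. by rewrite -(subrr (0 : A)) thetaB subrr. Qed.
Let thetaD x y : theta (x + y) = theta x + theta y.
Proof. by rewrite -{1}[y]opprK thetaB -[- y]sub0r thetaB theta0 sub0r opprK. Qed.

Lemma equivariant_fixed (R : {group gT}) x : R \subset H -> fixed R x -> fixed R (theta x).
Proof. by move=> /fintype.subsetP sRH Fx q qR; rewrite -thetaJ ?Fx ?sRH. Qed.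

(** An equivariant linear map commutes with relative traces. *)
Lemma equivariant_brauer_gen x :
  span (brauer_gen res P) x -> span (brauer_gen res P) (theta x).
Proof.
elim=> [_ [[Q [pQP [a Fa ->]]]|[c [a [c0 Fa ->]]]]||u v _ Hu _ Hv].
- have sQH : Q \subset H := fintype.subset_trans (proper_sub pQP) sPH.
  apply: SpanIn; left; exists Q; split=> //; exists (theta a).
    exact: equivariant_fixed.
  rewrite /reltr (big_morph theta thetaD theta0); apply: eq_bigr => C /rcosetsP[y yP ->].
  rewrite thetaJ //; case: repr_rcosetP => q qQ.
  exact: groupM (fintype.subsetP sQH _ qQ) (fintype.subsetP sPH _ yP).
- apply: SpanIn; right; exists c, (theta a); split=> //; exact: equivariant_fixed.
- by rewrite theta0; exact: Span0.
- by rewrite thetaB; exact: SpanB.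
Qed.

(** The map A(P) -> B(P) induced by [theta], evaluated at an arbitrary lift to
    A^P; [brauer_mapE] shows that the lift does not matter. *)
Definition brauer_map (q : brauer res A sPH) : brauer res B sPH :=
  Br res sPH (theta (val (generic_quotient.repr (q : quot_type (brauerIdeal res A sPH))))).

Lemma brauer_mapE x : fixed P x -> brauer_map (Br res sPH x) = Br res sPH (theta x).
Proof.
move=> Fx; rewrite -[x]/(val (sub_in (S := fixedSubalg A sPH) Fx)) BrE /brauer_map.
set u := sub_in _; set v := generic_quotient.repr _.
have Fv := sub_valP (S := fixedSubalg A sPH) v.
apply/Br_eq; [exact: equivariant_fixed|exact: equivariant_fixed|].
rewrite -thetaB; apply: equivariant_brauer_gen.
exact: (quot_repr (brauerIdeal res A sPH) u).
Qed.

Lemma brauer_mapB q r : brauer_map (q - r) = brauer_map q - brauer_map r.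
Proof.
have [x Fx ->] := Br_surj q; have [y Fy ->] := Br_surj r.
rewrite -BrB // !brauer_mapE //; last exact: fixedB.
by rewrite thetaB BrB //; exact: equivariant_fixed.
Qed.

Lemma brauer_map_act q h : h \in 'N_H(P) -> brauer_map (act q h) = act (brauer_map q) h.
Proof.
move=> hN; have [x Fx ->] := Br_surj q; have hH : h \in H by case/setIP: hN.
have Fxh : fixed P (act x h) by exact: (sa_act (s := fixedSubalg A sPH) hN Fx).
have Ftx : fixed P (theta x) by exact: equivariant_fixed.
by rewrite [X in brauer_map X]Br_act // !brauer_mapE // [RHS]Br_act // thetaJ.
Qed.

Lemma brauer_mapM : (forall x y, theta (x * y) = theta x * theta y) ->
  forall q r, brauer_map (q * r) = brauer_map q * brauer_map r.
Proof.
move=> thetaM q r; have [x Fx ->] := Br_surj q; have [y Fy ->] := Br_surj r.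
rewrite -[X in brauer_map X]BrM // !brauer_mapE //; last exact: fixedM.
by rewrite thetaM [LHS]BrM //; exact: equivariant_fixed.
Qed.

End BrauerFunctor.

Section TensorLift.
Variables (O : pzRingType) (gT : finGroupType) (L X : {group gT}).
Variables (B : interiorAlg O L X) (M : {group gT}) (nMX : M <| X) (sLM : L \subset M).
Variables (V : zmodType) (phi : gT -> B -> V).
Hypothesis phiB : forall x a b, phi x (a - b) = phi x a - phi x b.
Hypothesis phi_int : forall x y a, x \in M -> y \in L ->
  phi x (a * ia_int y) = phi (y * x)%g a.

Let phi0 x : phi x 0 = 0. Proof. by rewrite -(subrr (0 : B)) phiB subrr. Qed.

Definition skew_lift (f : skewAlg B nMX) : V :=
  \sum_(x : subg_of M) phi (sgval x) ((f : skew_type B nMX) x).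

Lemma skew_liftB f g : skew_lift (f - g) = skew_lift f - skew_lift g.
Proof. by rewrite -sumrB; apply: eq_bigr => x _; rewrite !ffunE phiB. Qed.

Lemma skew_lift_pure a x : x \in M -> skew_lift (skew_pure nMX a x) = phi x a.
Proof.
move=> xM; rewrite /skew_lift (bigD1 (subg M x)) //= big1 ?addr0.
  by rewrite ffunE eqxx subgK.
by move=> z zx; rewrite ffunE (negPf zx) phi0.
Qed.

Lemma skew_lift_tensor_set (f : skewAlg B nMX) : tensor_set f -> skew_lift f = 0.
Proof.
elim=> [_ [a [y [x [yL xM ->]]]]||u v _ Hu _ Hv].
- have yM := fintype.subsetP sLM _ yL.
  by rewrite skew_liftB !skew_lift_pure ?groupM // phi_int // subrr.
- by rewrite /skew_lift big1 // => x _; rewrite ffunE phi0.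
by rewrite skew_liftB Hu Hv subrr.
Qed.

(** Evaluated at an arbitrary representative; by [tens_lift_pi] the choice does
    not matter. *)
Definition tens_lift (q : tensor B nMX sLM) : V :=
  skew_lift (generic_quotient.repr (q : quot_type (tensorIdeal B nMX sLM))).

Lemma tens_lift_pi f : tens_lift (quot_pi (tensorIdeal B nMX sLM) f) = skew_lift f.
Proof.
apply/eqP; rewrite -subr_eq0 -skew_liftB; apply/eqP/skew_lift_tensor_set.
exact: (quot_repr (tensorIdeal B nMX sLM)).
Qed.

Lemma tens_liftE a x : x \in M -> tens_lift (tens nMX sLM a x) = phi x a.
Proof. by move=> xM; rewrite tens_lift_pi skew_lift_pure. Qed.

Lemma tens_liftB q r : tens_lift (q - r) = tens_lift q - tens_lift r.
Proof.
elim/quot_ind: q => f; elim/quot_ind: r => g.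
by rewrite -[X in tens_lift X](quot_piB (tensorIdeal B nMX sLM)) !tens_lift_pi skew_liftB.
Qed.

Lemma tens_lift_sum (I : Type) (r : seq I) (E : I -> tensor B nMX sLM) :
  tens_lift (\sum_(i <- r) E i) = \sum_(i <- r) tens_lift (E i).
Proof.
have t0 : tens_lift 0 = 0.
  by rewrite -(subrr (0 : tensor B nMX sLM)) tens_liftB subrr.
apply: (big_morph tens_lift) => // q s.
by rewrite -{1}[s]opprK tens_liftB -[- s]sub0r tens_liftB t0 sub0r opprK.
Qed.

End TensorLift.

Section TensorMaps.
Variables (O : pzRingType) (gT : finGroupType) (L X : {group gT}).
Variables (B : interiorAlg O L X) (M : {group gT}) (nMX : M <| X) (sLM : L \subset M).

Let MX x : x \in M -> x \in X. Proof. exact: (fintype.subsetP (normal_sub nMX)). Qed.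
Let LM x : x \in L -> x \in M. Proof. exact: (fintype.subsetP sLM). Qed.
Let tscal c : alg_scal (tensor B nMX sLM) c = tens nMX sLM (alg_scal B c) 1%g.
Proof. by rewrite tens_scal. Qed.

Lemma tens_scalM c a x : x \in M ->
  tens nMX sLM (alg_scal B c * a) x = alg_scal (tensor B nMX sLM) c * tens nMX sLM a x.
Proof. by move=> xM; rewrite tscal tensM // invg1 act1g mul1g. Qed.

(** ** The component of degree 1 *)

Definition deg1_at (x : gT) (a : B) : B := if x \in L then a * ia_int x else 0.

Let deg1_atB x a b : deg1_at x (a - b) = deg1_at x a - deg1_at x b.
Proof. by rewrite /deg1_at; case: ifP; rewrite ?mulrBl ?subr0. Qed.

Let deg1_at_int x y a : x \in M -> y \in L ->
  deg1_at x (a * ia_int y) = deg1_at (y * x) a.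
Proof.
move=> xM yL; rewrite /deg1_at groupMl //; case: ifP => // xL.
by rewrite -mulrA -ia_intM.
Qed.

(** The projection of B (x) OM on its component of degree 1, which is identified
    with B. It is what makes the grading direct at degree 1. *)
Definition tens_deg1 (q : tensor B nMX sLM) : B := tens_lift deg1_at q.

Lemma tens_deg1B q r : tens_deg1 (q - r) = tens_deg1 q - tens_deg1 r.
Proof. exact: tens_liftB. Qed.

Lemma tens_deg1E a x : x \in M -> tens_deg1 (tens nMX sLM a x) = deg1_at x a.
Proof. exact: tens_liftE. Qed.

Lemma tens_deg1Z c q :
  tens_deg1 (alg_scal (tensor B nMX sLM) c * q) = alg_scal B c * tens_deg1 q.
Proof.
have [f ->] := tens_sum q.
rewrite mulr_sumr /tens_deg1 !tens_lift_sum // mulr_sumr; apply: eq_bigr => x _.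
have xM := subgP x; rewrite -tens_scalM // !tens_liftE // /deg1_at.
by case: ifP; rewrite ?mulr0 ?mulrA.
Qed.

Lemma tens_deg1_act q h : h \in X -> tens_deg1 (act q h) = act (tens_deg1 q) h.
Proof.
move=> hX; have [f ->] := tens_sum q.
rewrite act_sum // /tens_deg1 !tens_lift_sum // act_sum //; apply: eq_bigr => x _.
have hN := fintype.subsetP (normal_norm nMX) _ hX.
have hL := fintype.subsetP (normal_norm (ia_normal B)) _ hX.
have xM := subgP x.
rewrite [X in tens_lift _ X]tens_act // !tens_liftE ?memJ_norm // /deg1_at memJ_norm //.
by case: ifP => xL; rewrite ?act0 // actMr // ia_intJ.
Qed.

Lemma tens_deg1_comp_neq1 s q : s <> 1%g -> tensor_comp s q -> tens_deg1 q = 0.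
Proof.
move=> s1 [a [x [xM Ex ->]]]; rewrite tens_deg1E // /deg1_at ifN //.
by apply/negP => xL; apply: s1; rewrite -Ex coset_id.
Qed.

Lemma tens_deg1_comp1 q : tensor_comp 1%g q -> q = tens nMX sLM (tens_deg1 q) 1%g.
Proof.
case=> a [x [xM Ex ->]].
have xL : x \in L.
  apply: coset_idr => //.
  by apply: (fintype.subsetP (normal_norm (ia_normal B))); exact: MX.
by rewrite tens_deg1E // /deg1_at xL tens_eq // mulg1.
Qed.

(** ** Algebra morphisms *)

Variables (B' : interiorAlg O M X) (iota : B -> B').
Hypothesis iotaB : forall a b, iota (a - b) = iota a - iota b.
Hypothesis iotaM : forall a b, iota (a * b) = iota a * iota b.
Hypothesis iotaJ : forall a h, h \in X -> iota (act a h) = act (iota a) h.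
Hypothesis iota_int : forall y, y \in L -> iota (ia_int y) = ia_int y.

Definition hom_at (x : gT) (a : B) : B' := iota a * ia_int x.

Let hom_atB x a b : hom_at x (a - b) = hom_at x a - hom_at x b.
Proof. by rewrite /hom_at iotaB mulrBl. Qed.

Let hom_at_int x y a : x \in M -> y \in L ->
  hom_at x (a * ia_int y) = hom_at (y * x) a.
Proof.
by move=> xM yL; rewrite /hom_at iotaM iota_int // -mulrA -ia_intM // LM.
Qed.

(** The elements of M are units of B' that act on it by conjugation, so that an
    L-interior morphism B -> B' extends by a (x) x |-> iota(a) x. *)
Definition tens_hom (q : tensor B nMX sLM) : B' := tens_lift hom_at q.

Lemma tens_homB q r : tens_hom (q - r) = tens_hom q - tens_hom r.
Proof. exact: tens_liftB. Qed.

Lemma tens_homE a x : x \in M -> tens_hom (tens nMX sLM a x) = iota a * ia_int x.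
Proof. exact: tens_liftE. Qed.

Lemma tens_homM q r : tens_hom (q * r) = tens_hom q * tens_hom r.
Proof.
have [f ->] := tens_sum q; have [g ->] := tens_sum r.
rewrite mulr_suml /tens_hom !tens_lift_sum // [RHS]mulr_suml; apply: eq_bigr => x _.
rewrite mulr_sumr tens_lift_sum // [RHS]mulr_sumr; apply: eq_bigr => y _.
have xM := subgP x; have yM := subgP y.
rewrite tensM // !tens_liftE ?groupM // /hom_at iotaM iotaJ ?groupV ?MX //.
rewrite ia_actE ?groupV // invgK ia_intM // !mulrA; congr (_ * _).
by rewrite -[LHS]mulrA -ia_intM ?groupV // mulVg ia_int1 mulr1.
Qed.

Lemma tens_hom_act q h : h \in X -> tens_hom (act q h) = act (tens_hom q) h.
Proof.
move=> hX; have [f ->] := tens_sum q.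
rewrite act_sum // /tens_hom !tens_lift_sum // act_sum //; apply: eq_bigr => x _.
have hN := fintype.subsetP (normal_norm nMX) _ hX.
have xM := subgP x.
rewrite [X in tens_lift _ X]tens_act // !tens_liftE ?memJ_norm // /hom_at.
by rewrite iotaJ // actMr // ia_intJ.
Qed.

End TensorMaps.

(** * The Brauer map between the extensions *)

Section Setting.
Variables (O k : pzRingType) (res : {rmorphism O -> k}).
Variables (gT : finGroupType) (K H : {group gT}) (A1 : interiorAlg O K H).
Variables (b : A1) (bP : block_idempotent b) (P : {group gT}) (sPK : P \subset K).

Local Notation A := (extAlg A1).
Local Notation Hb := (stabH b).
Local Notation Gb := (stabG b).
Local Notation gA := (extGrading A1).
Local Notation gAP := (APgrading A1 res sPK).
Local Notation gRP := (RPgrading A1 res sPK).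
Local Notation NKP := 'N_K(P)%G.
Local Notation sPH := (subKH A1 sPK).

Let sKH : K \subset H. Proof. exact: normal_sub (ia_normal A1). Qed.
Let KH x : x \in K -> x \in H. Proof. exact: (fintype.subsetP sKH). Qed.
Let HNK x : x \in H -> x \in 'N(K).
Proof. exact: (fintype.subsetP (normal_norm (ia_normal A1))). Qed.
Let PK x : x \in P -> x \in K. Proof. exact: (fintype.subsetP sPK). Qed.
Let Kb : fixed K b. Proof. by case: bP => -[]. Qed.
Let bb : b * b = b. Proof. by case: bP => -[]. Qed.
Let bZ a : b * a = a * b. Proof. by case: bP => _; apply. Qed.
Let Pb : fixed P b. Proof. exact: fixed_sub sPK Kb. Qed.

(** ** The component of degree 1 *)

Lemma to_extB a a' : to_ext (a - a') = to_ext a - to_ext a' :> A.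
Proof. exact: tensB. Qed.

Lemma to_extM a a' : to_ext (a * a') = to_ext a * to_ext a' :> A.
Proof. by rewrite [RHS]tensM // invg1 act1g mulg1. Qed.

Lemma to_extZ c a : to_ext (alg_scal A1 c * a) = alg_scal A c * to_ext a :> A.
Proof. exact: tens_scalM. Qed.

Lemma to_extJ a h : h \in H -> to_ext (act a h) = act (to_ext a : A) h.
Proof. by move=> hH; rewrite [RHS]tens_act // conj1g. Qed.

Lemma to_ext0 : to_ext 0 = 0 :> A.
Proof. by rewrite -(subrr (0 : A1)) to_extB subrr. Qed.

Lemma to_extD a a' : to_ext (a + a') = to_ext a + to_ext a' :> A.
Proof. by rewrite -{1}[a']opprK to_extB -[- a']sub0r to_extB to_ext0 sub0r opprK. Qed.

Definition ext_deg1 (q : A) : A1 := tens_deg1 q.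

Lemma ext_deg1K a : ext_deg1 (to_ext a) = a.
Proof. by rewrite [LHS]tens_deg1E // /deg1_at group1 ia_int1 mulr1. Qed.

(** The identification of A_1(P) with the component of degree 1 of A(P), and the
    projection of A(P) on it. *)
Definition iotaP : A1P A1 res sPK -> AP A1 res sPK := brauer_map (@to_ext _ _ _ _ A1).
Definition deg1P : AP A1 res sPK -> A1P A1 res sPK := brauer_map ext_deg1.

Lemma iotaPE a : fixed P a -> iotaP (Br res sPH a) = Br res sPH (to_ext a : A).
Proof. by move=> Fa; apply: brauer_mapE => //; [exact: to_extB|exact: to_extZ|exact: to_extJ]. Qed.

Lemma deg1PE u : fixed P u -> deg1P (Br res sPH u) = Br res sPH (ext_deg1 u).
Proof.
by move=> Fu; apply: brauer_mapE => //;
  [exact: tens_deg1B|exact: tens_deg1Z|move=> *; exact: tens_deg1_act].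
Qed.

Let to_ext_fixed (R : {group gT}) a : R \subset H -> fixed R a -> fixed R (to_ext a : A).
Proof. by apply: equivariant_fixed; exact: to_extJ. Qed.

Let ext_deg1_fixed (R : {group gT}) u : R \subset H -> fixed R u -> fixed R (ext_deg1 u).
Proof. by apply: equivariant_fixed => *; exact: tens_deg1_act. Qed.

Lemma iotaPB q r : iotaP (q - r) = iotaP q - iotaP r.
Proof. by apply: brauer_mapB; [exact: to_extB|exact: to_extZ|exact: to_extJ]. Qed.

Lemma iotaPM q r : iotaP (q * r) = iotaP q * iotaP r.
Proof. by apply: brauer_mapM; [exact: to_extB|exact: to_extZ|exact: to_extJ|exact: to_extM]. Qed.

Lemma iotaP_act q h : h \in 'N_H(P) -> iotaP (act q h) = act (iotaP q) h.
Proof. by apply: brauer_map_act; [exact: to_extB|exact: to_extZ|exact: to_extJ]. Qed.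

Lemma iotaP_int y : y \in 'C_K(P) -> iotaP (ia_int y) = ia_int y.
Proof.
move=> yC; have [yK _] := setIP yC.
have Fy := fixed_int A1 sPH yC.
rewrite [LHS](iotaPE Fy); congr Br; rewrite /to_ext -[ia_int y]mul1r tens_eq //; first by rewrite mulg1.
Qed.

Lemma deg1PB q r : deg1P (q - r) = deg1P q - deg1P r.
Proof.
by apply: brauer_mapB; [exact: tens_deg1B|exact: tens_deg1Z|move=> *; exact: tens_deg1_act].
Qed.

Lemma deg1P_act q h : h \in 'N_H(P) -> deg1P (act q h) = act (deg1P q) h.
Proof.
by apply: brauer_map_act; [exact: tens_deg1B|exact: tens_deg1Z|move=> *; exact: tens_deg1_act].
Qed.

Lemma iotaPK q : deg1P (iotaP q) = q.
Proof.
have [a Fa ->] := Br_surj q; rewrite iotaPE // deg1PE ?ext_deg1K //.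
exact: to_ext_fixed sPH Fa.
Qed.

Lemma deg1PK q : gr_comp gAP 1%g q -> iotaP (deg1P q) = q.
Proof.
case=> u [Fu cu ->]; have Fdu := ext_deg1_fixed sPH Fu.
by rewrite deg1PE // iotaPE //; congr Br; rewrite [RHS](tens_deg1_comp1 cu).
Qed.

Lemma deg1P_neq1 s q : s <> 1%g -> gr_comp gAP s q -> deg1P q = 0.
Proof.
move=> s1 [u [Fu cu ->]]; rewrite deg1PE // /ext_deg1 (tens_deg1_comp_neq1 s1 cu).
exact: Br0.
Qed.

Lemma iotaP_bbar : iotaP (bbar res b sPK) = bbarA res b sPK.
Proof. exact: iotaPE. Qed.

Lemma AP_jac_degree1 x : corner gAP NKP (bbarA res b sPK) 1%g x ->
  mulspan (crossed_set gAP NKP (bbarA res b sPK) Gb) (jac1 (corner_axioms3 res sPK bP)) x ->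
  jac1 (corner_axioms3 res sPK bP) x.
Proof.
have d0 : deg1P 0 = 0 by rewrite -(subrr (0 : AP A1 res sPK)) deg1PB subrr.
apply: (jac_degree1 deg1PB) => [s q _ s1|q cq dq]; first exact: deg1P_neq1.
rewrite -(deg1PK cq) dq -(subrr (0 : A1P A1 res sPK)) iotaPB subrr //.
Qed.

(** ** Comparison of C and E *)

Lemma gr_comp_sum (I : finType) (B : pred I) (E : I -> A) s : s \in gr_grp gA ->
  (forall i, B i -> gr_comp gA s (E i)) -> gr_comp gA s (\sum_(i | B i) E i).
Proof.
move=> sG cE; apply: (big_ind (gr_comp gA s)) => //; first exact: gr0.
move=> x y cx cy; rewrite -[y]opprK -[- y]sub0r.
by do 2!apply: grB => //; exact: gr0.
Qed.

Hypothesis dP : defect_group res b sPK.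

Lemma bbarA_neq0 : bbarA res b sPK <> 0.
Proof.
case: dP => _ nz E; apply: nz; rewrite -(iotaPK (bbar res b sPK)) iotaP_bbar E.
by rewrite -(subrr (0 : AP A1 res sPK)) deg1PB subrr.
Qed.

Lemma Br_corner_morphism :
  corner_morphism gA K (to_ext b) Gb gAP NKP (bbarA res b sPK) Gb
    (fixed P) (Br res sPH) id.
Proof.
have ax := corner_axioms1 bP.
split=> //.
- by move=> x y; exact: (fixedB sPH).
- by move=> x y; exact: (fixedM sPH).
- by move=> x y; exact: BrB.
- by move=> x y; exact: BrM.
- by move=> s x sG /(cornerP ax _ sG)[_ Fx]; exact: fixed_sub sPK Fx.
move=> s x sG [u [cu Fu ->]]; have FPu := fixed_sub sPK Fu.
exists (Br res sPH u); split; first by exists u.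
- move=> q /setIP[qK qN]; rewrite [LHS]Br_act // ?Fu //.
  by rewrite inE KH.
by rewrite [LHS]BrM //; exact: (to_ext_fixed sPH).
Qed.

(** As b is the trace from P of some c, an element Br_P(u) fixed by N_K(P)
    satisfies Br_P(Tr_P^K(cu)) = Tr(Br_P(c) Br_P(u)) = Tr(Br_P(c)) Br_P(u)
    = Br_P(b) Br_P(u), the traces on A(P) being from P to N_K(P). *)
Lemma Br_corner_onto s y : s \in Gb -> corner gAP NKP (bbarA res b sPK) s y ->
  exists2 x, corner gA K (to_ext b) s x & Br res sPH x = y.
Proof.
move=> sG [_ [[u [Fu cu ->]] FBu ->]].
have [[c Fc Eb] _] := dP.
have FPc : fixed P (to_ext c : A) by exact: (to_ext_fixed sPH).
have FPcu : fixed P (to_ext c * u : A) by exact: (fixedM sPH).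
have ax := corner_axioms1 bP.
have sgr : s \in gr_grp gA := fintype.subsetP (ca_Gr ax) _ sG.
pose t : A := reltr P K (to_ext c * u : A).
have Ft : fixed K t by exact: fixed_reltr.
have ct : gr_comp gA s t.
  apply: gr_comp_sum => // C CR; have rK : repr C \in K.
    have [x xK ->] := rcosetsP CR; case: (repr_rcosetP P x) => z zP.
    by rewrite groupM // PK.
  rewrite -[s](conjg1) -(coset_id rK); apply: gr_act => //; first exact: KH.
  rewrite -[s]mul1g; apply: grM => //; exists c, 1%g; split=> //.
  by rewrite morph1.
exists (to_ext b * t); first by exists t.
have FPb : fixed P (to_ext b : A) by exact: (to_ext_fixed sPH).
rewrite BrM //; last exact: fixed_sub sPK Ft.
rewrite [Br _ _ t](Br_reltr res sPH sKH sPK FPcu).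
have Ebb : Br res sPH (to_ext b : A) * Br res sPH (to_ext b : A) = Br res sPH (to_ext b : A).
  by rewrite -BrM // -to_extM bb.
rewrite /bbarA -[in RHS]Ebb -[RHS]mulrA; congr (_ * _).
have -> : (to_ext b : A) = reltr P K (to_ext c : A).
  rewrite Eb /reltr (big_morph (@to_ext _ _ _ _ A1) to_extD to_ext0).
  apply: eq_bigr => C CR; rewrite to_extJ //.
  have [x xK ->] := rcosetsP CR; case: (repr_rcosetP P x) => z zP.
  by rewrite KH // groupM // PK.
rewrite (Br_reltr res sPH sKH sPK FPc) [RHS]mulr_suml.
apply: eq_bigr => C CR; have rN : repr C \in NKP.
  have [x xN ->] := rcosetsP CR; case: (repr_rcosetP P x) => z zP.
  by rewrite groupM // inE PK // (fintype.subsetP (normG P)).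
have rNH : repr C \in 'N_H(P) by case/setIP: rN => rK rN; rewrite inE KH.
by rewrite BrM // [LHS]actMr // FBu.
Qed.

(** ** Supports *)

Hypothesis loc : local_ring (C1 bP).

(** For the inclusion from right to left, lift an equation for Br_P(b) in
    E_s E_(s^-1) to an element x of C_s C_(s^-1) with Br_P(b - x) = 0. Then
    b - x is not a unit of the local ring C_1, so that x is one. *)
Lemma supp_b_bbar : supp_b b = supp_bbar res b sPK.
Proof.
have ax := corner_axioms1 bP; have cm := Br_corner_morphism.
apply/setP=> s; apply/idP/idP => [|sG].
  exact: (cm_support ax (corner_axioms3 res sPK bP) cm).
have /(corner_supportP (corner_axioms3 res sPK bP))[sGb Hb'] := sG.
apply/(corner_supportP ax); split=> //.
have [x [Hx FPx Ex]] : exists x, [/\ mulspan (corner gA K (to_ext b) s)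
    (corner gA K (to_ext b) s^-1%g) x, fixed P x & Br res sPH x = bbarA res b sPK].
  have sVGb : (s^-1)%g \in Gb by rewrite groupV.
  elim: Hb' => [_ [y [z [Ey Ez ->]]]||u v _ [x [Hx Fx <-]] _ [y [Hy Fy <-]]].
  - have [y0 Cy <-] := Br_corner_onto sGb Ey; have [z0 Cz <-] := Br_corner_onto sVGb Ez.
    have Fy := cmD cm sGb Cy; have Fz := cmD cm sVGb Cz.
    exists (y0 * z0); split; [|exact: (fixedM sPH)|exact: BrM].
    by apply: SpanIn; exists y0, z0.
  - by exists 0; split; [exact: Span0|exact: (fixed0 A sPH)|exact: Br0].
  by exists (x - y); split; [exact: SpanB|exact: (fixedB sPH)|exact: BrB].
have Cx := mulspan_corner1 ax sGb Hx.
pose x1 : C1 bP := sub_in (S := unitSubalg ax) Cx.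
case: loc => _ /(_ x1 (1 - x1)) [|[y [xy _]]|[y [xy _]]].
- by rewrite addrC subrK; exists 1; rewrite mulr1.
- (* x is a unit of C_1, and C_s C_(s^-1) is an ideal of C_1 *)
  have Eby : to_ext b = x * val y by rewrite -[LHS](congr1 val xy).
  by rewrite [X in mulspan _ _ X]Eby; apply: (mulspan_cornerMr ax) => //; exact: (sub_valP (S := unitSubalg ax) y).
have Cy := sub_valP (S := unitSubalg ax) y.
have Fb := cmD cm (group1 Gb) (corner1_e ax).
have Fy := cmD cm (group1 Gb) Cy.
case: bbarA_neq0; rewrite /bbarA.
have -> : to_ext b = (to_ext b - x) * val y by rewrite -[LHS](congr1 val xy).
by rewrite BrM ?BrB ?Ex ?subrr ?mul0r //; exact: (fixedB sPH).
Qed.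

(** ** Inertia groups *)

Lemma bbar_act h : h \in 'N_H(P) -> act (bbar res b sPK) h = Br res sPH (act b h).
Proof. by move=> hN; rewrite [LHS]Br_act. Qed.

(** The idempotent b b^h is below the primitive b, hence is 0 or b. The Brauer
    map sends it to Br_P(b), which is nonzero. *)
Lemma Br_stab_mul h : h \in 'N_H(P) -> act (bbar res b sPK) h = bbar res b sPK ->
  b * act b h = b.
Proof.
move=> hN; rewrite bbar_act // => Eh.
have hH : h \in H by case/setIP: hN.
have [[_ _ _ prim] _] := bP.
set b' := act b h; have b'b' : b' * b' = b' by rewrite -actMr // bb.
have Kb' : fixed K b'.
  move=> y yK; have hN' := HNK hH.
  have yK' : (y ^ h^-1)%g \in K by rewrite memJ_norm // groupV.
  by rewrite -(actMg _ hH (KH yK)) conjgCV (actMg _ (KH yK') hH) Kb.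
have Kbb' : fixed K (b * b') by exact: (fixedM sKH).
have ebb' : b * b' * (b * b') = b * b' by rewrite -mulrA (mulrA b') -bZ !mulrA bb -mulrA b'b'.
have bb'b : b * b' * b = b * b' by rewrite -bZ mulrA bb.
case: (prim (b * b') (b - b * b')) => //.
- exact: (fixedB sKH).
- by rewrite mulrBl !mulrBr ebb' bb'b mulrA !bb subrr subr0.
- by rewrite mulrBr bb'b ebb' subrr.
- by rewrite mulrBl ebb' mulrA bb subrr.
- by rewrite addrC subrK.
- move=> E0; case: dP => _; case.
  have Fb' : fixed P b' := fixed_sub sPK Kb'.
  transitivity (Br res sPH (b * b')); last by rewrite E0; exact: Br0.
  by rewrite BrM // Eh -BrM // bb.
by move/subr0_eq.
Qed.

(** If h fixes Br_P(b), so does its inverse; [Br_stab_mul] then gives b b^h = b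
    and b b^h = b^h. *)
Lemma NHb_bbar : NHb b P = NHbbar res b sPK :> {set gT}.
Proof.
apply/setP=> h; rewrite [LHS]in_set [RHS]in_set.
case: (boolP (h \in 'N_H(P))) => //= hN.
have hH : h \in H by case/setIP: hN.
apply/eqP/eqP => [Eh|Eh]; first by rewrite [LHS](bbar_act hN) Eh.
have E1 := Br_stab_mul hN Eh.
have hVN : (h^-1)%g \in 'N_H(P) by rewrite groupV.
have EV : act (bbar res b sPK) h^-1 = bbar res b sPK by rewrite -[in LHS]Eh actK.
have := congr1 (fun a => act a h) (Br_stab_mul hVN EV).
by rewrite actMr // actKV // -bZ E1.
Qed.

(** A Frattini argument: for h fixing b, both P and P^h are defect groups of b,
    hence conjugate in K. *)
Lemma stabH_frattini : Hb = (NHb b P * K)%g :> {set gT}.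
Proof.
apply/setP=> h; apply/idP/mulsgP => [|[n y]].
  rewrite inE => /andP[hH /eqP hb].
  have [[c Fc Eb] nz] := dP.
  have hNK : h \in 'N_H(K) by rewrite inE hH HNK.
  have sPhK : P :^ h \subset K by rewrite -(normP (HNK hH)) conjSg.
  have Fch : fixed (P :^ h)%G (act c h).
    move=> _ /imsetP[q qP ->]; have qH := KH (PK qP).
    by rewrite -(actMg _ hH (groupJ qH hH)) -conjgC (actMg _ qH hH) Fc.
  have Ebh : b = reltr (P :^ h)%G K (act c h) by rewrite -(reltr_act sKH hNK sPK Fc) -Eb.
  have [|x xK sPx] := brauer_trace_conj (res := res) (sPH := sPH) sKH sPhK sPK Fch.
    by rewrite -Ebh.
  exists (h * x)%g (x^-1)%g; rewrite ?groupV // ?mulgK //.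
  have xH := KH xK.
  have NPhx : (h * x)%g \in 'N(P).
    by apply/normP/eqP; rewrite eq_sym eqEcard conjsgM sPx !cardJg /=.
  by rewrite in_set in_setI groupM //= NPhx (actMg _ hH xH) hb Kb // eqxx.
rewrite !inE => /andP[/andP[nH _] /eqP nb] yK ->.
by rewrite (actMg _ nH (KH yK)) nb Kb // eqxx andbT groupM // KH.
Qed.

(** * The local extension *)

Local Notation ax2 := (corner_axioms2 res sPK bP).
Local Notation ax3 := (corner_axioms3 res sPK bP).
Local Notation GR := (CHbbar res b sPK / 'C_K(P))%G.
Local Notation LP := ('C_K(P))%G.

Let CHN x : x \in 'C_H(P) -> x \in 'N(LP).
Proof.
move=> xC; apply: (fintype.subsetP (normal_norm (ia_normal (A1P A1 res sPK)))).
exact: (fintype.subsetP (normal_sub (cent_normal_norm A1 res sPK))).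
Qed.

Lemma natural_monoE x : x \in 'C_H(P) -> natural_mono (coset LP x) = coset K x.
Proof.
move=> xC; rewrite /natural_mono val_coset ?CHN //.
by case: repr_rcosetP => y /setIP[yK _]; rewrite coset_kerl.
Qed.

(** Its value at a (x) x is a x, for a in A_1(P) and x in C_H(P), both mapped
    to A(P). *)
Definition RP_hom : RP A1 res sPK -> AP A1 res sPK := tens_hom iotaP.

Lemma RP_homE a x : x \in 'C_H(P) ->
  RP_hom (tens (cent_normal_norm A1 res sPK) (centS A1 P) a x) = iotaP a * ia_int x.
Proof. by apply: tens_homE; [exact: iotaPB|exact: iotaPM|exact: iotaP_int]. Qed.

Lemma RP_homB q r : RP_hom (q - r) = RP_hom q - RP_hom r.
Proof. by apply: tens_homB; [exact: iotaPB|exact: iotaPM|exact: iotaP_int]. Qed.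

Lemma RP_homM q r : RP_hom (q * r) = RP_hom q * RP_hom r.
Proof.
by apply: tens_homM; [exact: iotaPB|exact: iotaPM|move=> *; exact: iotaP_act|exact: iotaP_int].
Qed.

Lemma RP_hom_act q h : h \in 'N_H(P) -> RP_hom (act q h) = act (RP_hom q) h.
Proof.
by apply: tens_hom_act; [exact: iotaPB|exact: iotaPM|move=> *; exact: iotaP_act|exact: iotaP_int].
Qed.

Lemma RP_hom_corner_morphism :
  corner_morphism gRP NKP (bbarR res b sPK) GR gAP NKP (bbarA res b sPK) Gb
    (fun _ => True) RP_hom (@natural_mono gT K P).
Proof.
have GRP t : t \in GR -> exists x, [/\ x \in 'C_H(P), t = coset LP x & x \in CHbbar res b sPK].
  by case/morphimP=> x _ xC ->; exists x; split=> //; move: xC; rewrite inE => /andP[].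
have Ee : RP_hom (bbarR res b sPK) = bbarA res b sPK.
  by rewrite RP_homE ?group1 // ia_int1 mulr1 iotaP_bbar.
have FK q : fixed NKP q -> fixed NKP (RP_hom q).
  move=> Fq h hN; rewrite -RP_hom_act ?Fq //.
  by case/setIP: hN => hK hN; rewrite inE KH.
split=> //.
- by move=> x y _ _; exact: RP_homB.
- by move=> x y _ _; exact: RP_homM.
- move=> t q _ [u [[a [x [xC Ex ->]]] Fu ->]].
  exists (RP_hom (tens (cent_normal_norm A1 res sPK) (centS A1 P) a x)); split.
  + rewrite RP_homE // -Ex natural_monoE //.
    have [a0 Fa0 ->] := Br_surj a; rewrite iotaPE //.
    have Ft := to_ext_fixed sPH Fa0; have Fx := fixed_int A sPH xC.
    have xH : x \in H by case/setIP: xC.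
    exists (to_ext a0 * ia_int x); split; [exact: (fixedM sPH)| |by rewrite BrM].
    exists a0, x; split=> //.
    by rewrite [LHS]tensM // invg1 act1g mulr1 mul1g.
  + exact: FK.
  by rewrite RP_homM Ee.
- move=> t /GRP[x [xC -> xb]]; rewrite natural_monoE //; apply: mem_quotient.
  have xb' : x \in NHbbar res b sPK.
    move: xb; rewrite [X in is_true X -> _]in_set => /andP[_ xb]; rewrite in_set xb andbT.
    exact: (fintype.subsetP (normal_sub (cent_normal_norm A1 res sPK))).
  move: xb'; rewrite -NHb_bbar [X in is_true X -> _]in_set => /andP[/setIP[xH _] xb'].
  by rewrite in_set xH.
move=> t s /GRP[x [xC -> _]] /GRP[y [yC -> _]].
have xH : x \in H by case/setIP: xC.
have yH : y \in H by case/setIP: yC.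
by rewrite -morphM ?CHN // !natural_monoE ?groupM // morphM ?HNK.
Qed.

(* the projection of A(P) on degree 1 inverts RP_hom on R_1 *)
Let RP1 q : gr_comp gRP 1%g q ->
  q = tens (cent_normal_norm A1 res sPK) (centS A1 P) (deg1P (RP_hom q)) 1%g.
Proof.
move=> cq; rewrite {1}(tens_deg1_comp1 cq); congr tens.
by rewrite {2}(tens_deg1_comp1 cq) RP_homE ?group1 // ia_int1 mulr1 iotaPK.
Qed.

Lemma RP_hom_inj1 x y :
    corner gRP NKP (bbarR res b sPK) 1%g x -> corner gRP NKP (bbarR res b sPK) 1%g y ->
  RP_hom x = RP_hom y -> x = y.
Proof.
move=> Cx Cy Exy; have Tx := RP1 (corner_gr ax2 (group1 GR) Cx).
by rewrite Tx Exy -(RP1 (corner_gr ax2 (group1 GR) Cy)).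
Qed.

(** The unique preimage in R_1 of a fixed element is fixed, R_1 and A(P)_1 both
    being A_1(P). *)
Lemma RP_hom_onto1 y : corner gAP NKP (bbarA res b sPK) 1%g y ->
  exists2 x, corner gRP NKP (bbarR res b sPK) 1%g x & RP_hom x = y.
Proof.
move=> Ey; have [_ Fy] := iffLR (cornerP ax3 _ (group1 Gb)) Ey.
have Edy := deg1PK (corner_gr ax3 (group1 Gb) Ey).
have ey : bbarA res b sPK * y = y by exact: (sa1M (s := unitSubalg ax3)).
pose q : RP A1 res sPK := tens (cent_normal_norm A1 res sPK) (centS A1 P) (deg1P y) 1%g.
have Eq : RP_hom q = y by rewrite RP_homE ?group1 // ia_int1 mulr1.
exists q => //; apply/(cornerP ax2 _ (group1 GR)); split.
  exists q; first by exists (deg1P y), 1%g; rewrite morph1.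
  rewrite [RHS]tensM ?group1 // invg1 act1g mulg1; congr tens.
  by apply: (can_inj iotaPK); rewrite iotaPM Edy iotaP_bbar ey.
move=> h hN; have hNH : h \in 'N_H(P) by case/setIP: hN => hK hN; rewrite inE KH.
by rewrite [LHS]tens_act ?group1 // conj1g -deg1P_act // Fy.
Qed.

Lemma natural_mono_inj : {in supp_CH res b sPK &, injective (@natural_mono gT K P)}.
Proof.
move=> t s /(corner_supportP ax2)[tG _] /(corner_supportP ax2)[sG _].
case/morphimP: tG => x _ xC ->; case/morphimP: sG => y _ yC ->.
have {}xC : x \in 'C_H(P) by move: xC; rewrite inE => /andP[].
have {}yC : y \in 'C_H(P) by move: yC; rewrite inE => /andP[].
rewrite !natural_monoE // => /rcoset_kercosetP; case/setIP: (xC) => xH xP.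
case/setIP: (yC) => yH yP; rewrite !HNK // mem_rcoset => /(_ isT isT) xyK.
apply/rcoset_kercosetP; rewrite ?CHN // mem_rcoset inE xyK.
by rewrite groupM ?groupV.
Qed.

Lemma natural_monoJ h t : h \in 'N_H(P) -> t \in GR ->
  natural_mono (K := K) (t ^ coset LP h) = (natural_mono t ^ coset K h)%g.
Proof.
move=> hN; case/morphimP=> x _ xC ->.
have {}xC : x \in 'C_H(P) by move: xC; rewrite inE => /andP[].
have xH : x \in H by case/setIP: xC.
have hH : h \in H by case/setIP: hN.
have hL : h \in 'N(LP).
  exact: (fintype.subsetP (normal_norm (ia_normal (A1P A1 res sPK)))).
have xhC : (x ^ h)%g \in 'C_H(P).
  by rewrite memJ_norm //; exact: (fintype.subsetP (normal_norm (cent_normal_norm A1 res sPK))).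
have -> : (coset LP x ^ coset LP h)%g = coset LP (x ^ h)%g by rewrite morphJ //; exact: CHN.
by rewrite !natural_monoE // morphJ ?HNK.
Qed.

End Setting.

(** * The theorem *)

Lemma inj_surj_bij (T U : Type) (f : T -> U) :
  injective f -> (forall u, exists t, f t = u) -> bijective f.
Proof.
move=> f_inj f_surj; have g u := boolp.cid (f_surj u).
exists (fun u => projT1 (g u)) => [t|u]; last exact: projT2 (g u).
by apply: f_inj; exact: projT2 (g (f t)).
Qed.

Theorem theorem7p3
  (p : nat) (O : idomainType) (k : fieldType) (res : {rmorphism O -> k})
  (gT : finGroupType) (K H : {group gT}) (A1 : interiorAlg O K H)
  (b : A1) (bP : block_idempotent b) (P : {group gT}) (sPK : P \subset K) :
  prime p -> p \in [pchar k] ->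
  discrete_valuation_ring O \/ is_field O ->
  (forall x : k, exists c : O, res c = x) ->
  K <| H ->
  p.-group P -> defect_group res b sPK ->
  local_ring (C1 bP) ->
  [/\ stabG b = (NHb b P * K / K)%g :> {set coset_of K}
        /\ (NHb b P * K / K)%g = (NHbbar res b sPK * K / K)%g,
      supp_b b = supp_bbar res b sPK /\ supp_bbar res b sPK = supp_NH res b sPK,
      exists f : ext1 bP -> ext3 res sPK bP,
        ext_isomorphism f id /\ ext_equivariant (NHbbar res b sPK) f
    & exists f : ext2 res sPK bP -> ext3 res sPK bP,
        ext_monomorphism f (@natural_mono gT K P)
          /\ ext_equivariant (NHbbar res b sPK) f].
Proof.
move=> _ _ _ _ _ _ dP loc.
have supp_eq : supp_b b = supp_bbar res b sPK by exact: supp_b_bbar.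
have GbE : stabG b = (NHb b P * K / K)%g :> {set coset_of K}.
  by rewrite /= (stabH_frattini bP dP).
have sN3 : NHbbar res b sPK \subset NHb b P by rewrite -(NHb_bbar bP dP).
have sN1 : NHbbar res b sPK \subset stabH b.
  apply: fintype.subset_trans sN3 _; rewrite (stabH_frattini bP dP).
  exact: mulG_subl.
have sNN : NHbbar res b sPK \subset 'N_H(P).
  by apply/fintype.subsetP => h; rewrite in_set => /andP[].
pose ax1 := corner_axioms1 bP; pose ax2 := corner_axioms2 res sPK bP.
pose ax3 := corner_axioms3 res sPK bP.
have jac3 := @AP_jac_degree1 _ _ res _ _ _ _ _ bP _ sPK.
split.
- by split=> //; rewrite (NHb_bbar bP dP).
- by split=> //; rewrite /supp_bbar /supp_NH -GbE.
- have cm := Br_corner_morphism res bP sPK.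
  have onto1 y := @Br_corner_onto _ _ res _ _ _ _ _ bP _ sPK dP 1%g y (group1 (stabG b)).
  have refl1 := @cm_reflect_local _ _ _ _ _ _ _ _ _ _ ax1 _ _ _ _ _ _ _ _ ax3 _ _ _ cm loc
    (bbarA_neq0 bP dP).
  have c_inj : {in supp_b b &, injective (id : coset_of K -> coset_of K)} by [].
  exists (cm_hU (ax := ax1) ax3 cm onto1); split.
    have [fM f_inj _] := cm_hU_monomorphism (ax := ax1) (ax' := ax3) cm onto1 jac3 refl1 c_inj.
    split=> //; last by rewrite imset_id.
    apply: inj_surj_bij => //; apply: cm_hU_surj => // [s y|t tG].
      exact: Br_corner_onto.
    by exists t => //; move: tG; rewrite -/(supp_bbar res b sPK) -supp_eq.
  apply: cm_hU_equivariant => // h x hN Fx.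
  by rewrite [LHS]Br_act // (fintype.subsetP sNN).
have cm := RP_hom_corner_morphism bP dP.
have onto1 y := @RP_hom_onto1 _ _ res _ _ _ _ _ bP _ sPK y.
have refl1 := @cm_reflect_inj _ _ _ _ _ _ _ _ _ _ ax2 _ _ _ _ _ _ _ _ ax3 _ _ _ cm onto1
  (@RP_hom_inj1 _ _ res _ _ _ _ _ bP _ sPK).
have c_inj := @natural_mono_inj _ _ res _ _ _ _ _ bP _ sPK.
exists (cm_hU (ax := ax2) ax3 cm onto1); split.
  exact: (cm_hU_monomorphism (ax := ax2) (ax' := ax3) cm onto1 jac3 refl1 c_inj).
apply: cm_hU_equivariant => // [h x hN _|h t hN tG].
  by rewrite RP_hom_act // (fintype.subsetP sNN).
have /(corner_supportP ax2)[tGR _] := tG.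
by apply: natural_monoJ tGR => //; exact: (fintype.subsetP sNN).
Qed.
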